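(* Let $\underline T=(T_1,\dots,T_d)$ be a tuple of commuting contractions on a Hilbert space $\mathcal H$ such that $P^n\nrightarrow 0$ strongly, where $P=T_1T_2\cdots T_d$. Then there exists a canonical unitary pseudo-extension $(\mathfrak J,\mathcal K,\underline U)$ of $\underline T$, $\underline U=(U_1,\dots,U_d)$, such that: (1) (Pseudo-compression) The map $\Gamma$ defined on $\{U_1,\dots,U_d\}'$ by $\Gamma(Y)=\mathfrak J^*Y\mathfrak J$ is a complete isometry onto $\mathcal T(\underline T)$. (2) (Representation) There exists a surjective unital $*$-representation $\pi: C^*(I_{\mathcal H},\mathcal T(\underline T))\to\{U_1,\dots,U_d\}'$ such that $\pi\circ\Gamma=I$. (3) (Commutant pseudo-extension) There exists a completely contractive, unital and multiplicative mapping $\Theta:\{T_1,\dots,T_d\}'\to\{U_1,\dots,U_d\}'$ defined by $\Theta(X)=\pi(\mathfrak J^*\mathfrak JX)$, which satisfies $\Theta(X)\mathfrak J=\mathfrak JX$ for every $X\in\{T_1,\dots,T_d\}'$.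
   Context: Hilbert spaces are complex; operators are bounded and linear. For a set $S$ of operators on a Hilbert space, $S'$ denotes its commutant, i.e., the set of bounded operators on that space commuting with every element of $S$. $\mathcal T(\underline T)=\{A\in\mathcal B(\mathcal H): T_i^*AT_i=A\text{ for }1\le i\le d\}$ is the space of $\underline T$-Toeplitz operators, and $C^*(I_{\mathcal H},\mathcal T(\underline T))\subseteq\mathcal B(\mathcal H)$ is the $C^*$-algebra generated by $I_{\mathcal H}$ and $\mathcal T(\underline T)$. A pseudo-extension of a $d$-tuple $\underline T$ of commuting bounded operators on $\mathcal H$ is a triple $(\mathfrak J,\mathcal K,\underline U)$ where $\mathcal K$ is a Hilbert space, $\underline U=(U_1,\dots,U_d)$ is a $d$-tuple of commuting bounded operators on $\mathcal K$, and $\mathfrak J:\mathcal H\to\mathcal K$ is a non-zero contraction with $\mathfrak J T_j=U_j\mathfrak J$ for every $j$. It is unitary if every $U_j$ is unitary. It is minimal if $\mathcal K$ is the smallest closed subspace reducing each $U_j$ and containing $\mathfrak J\mathcal H$. A minimal pseudo-extension of a tuple of commuting contractions is canonical if $\mathfrak J^*\mathfrak J=\operatorname{SOT-}\lim_{n\to\infty}P^{*n}P^n$. A linear map between operator spaces (subspaces of some $\mathcal B(\mathcal H)$, $\mathcal B(\mathcal K)$) is completely contractive (resp. a complete isometry) if all its entrywise amplifications to $n\times n$ matrices, $n\ge1$, are contractive (resp. isometric). *)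

(* Defs.v *)
(* The complex numbers are R[i], for an arbitrary R : realType. *)
From HB Require Import structures.
From mathcomp Require Import all_boot all_order all_algebra.
From mathcomp Require Import all_classical all_reals all_analysis.
From mathcomp Require Import complex.

Set Implicit Arguments.
Unset Strict Implicit.
Unset Printing Implicit Defensive.

Import Order.TTheory GRing.Theory Num.Theory.
Import numFieldNormedType.Exports.

Local Open Scope classical_set_scope.
Local Open Scope ring_scope.
Local Open Scope complex_scope.

(* The inner product is linear in its first argument. *)
HB.mixin Record CompleteNormedModule_isHilbert (R : realType) H
    & CompleteNormedModule R[i] H := {
  inner : {dot H for (@Num.conj R[i])} ;
  inner_normE : forall x : H, `|x| ^+ 2 = inner x x
}.

#[short(type="hilbertType")]
HB.structure Definition Hilbert (R : realType) :=
  {H of CompleteNormedModule R[i] H & CompleteNormedModule_isHilbert R H}.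

Definition linear_subspace (R : realType) (V : lmodType R[i]) (M : set V) :=
  M 0 /\ forall (a : R[i]) (x y : V), M x -> M y -> M (a *: x + y).

Section operators.
Context {R : realType}.
Implicit Types H K : hilbertType R.

(* The norm of H takes its (real) values in R[i]; rnorm takes them in R. *)
Definition rnorm H (x : H) : R := complex.Re `|x|.

(* Operators are functions satisfying bounded_operator; sums and scalar
   multiples of operators are those of the pointwise lmodType structure. *)
Definition bounded_operator H K (A : H -> K) :=
  linear A /\ exists M : R, forall x, rnorm (A x) <= M * rnorm x.

Definition opnorm H K (A : H -> K) : R :=
  sup [set rnorm (A x) | x in [set x | rnorm x <= 1]].

Definition contractive H K (A : H -> K) :=
  bounded_operator A /\ opnorm A <= 1.

(* For bounded A, the Riesz representation theorem provides exactly one such z. *)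
Definition adj H K (A : H -> K) (y : K) : H :=
  xget 0 [set z | forall x, inner (A x) y = inner x z].

Definition unitary_operator H (A : H -> H) :=
  [/\ bounded_operator A, adj A \o A = idfun & A \o adj A = idfun].

Definition commutant H (S : set (H -> H)) : set (H -> H) :=
  [set A | bounded_operator A /\ forall B, S B -> A \o B = B \o A].

Definition cstar_subalgebra H (S : set (H -> H)) :=
  [/\ S `<=` @bounded_operator H H,
      linear_subspace S,
      forall A B, S A -> S B -> S (A \o B),
      forall A, S A -> S (adj A)
    & forall A, bounded_operator A ->
        (forall e : R, 0 < e -> exists2 B, S B & opnorm (A - B) < e) -> S A].

Definition cstar_generated H (X : set (H -> H)) : set (H -> H) :=
  smallest (@cstar_subalgebra H) X.

Definition linear_on H K (S : set (H -> H)) (phi : (H -> H) -> (K -> K)) :=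
  forall (a : R[i]) A B, S A -> S B -> phi (a *: A + B) = a *: phi A + phi B.

Definition multiplicative_on H K (S : set (H -> H))
    (phi : (H -> H) -> (K -> K)) :=
  forall A B, S A -> S B -> phi (A \o B) = phi A \o phi B.

Definition unital H K (phi : (H -> H) -> (K -> K)) := phi idfun = idfun.

(* A unital *-representation of the operator algebra S with values in B(K);
   the values of pi outside S are irrelevant. *)
Definition unital_star_representation H K (S : set (H -> H))
    (pi : (H -> H) -> (K -> K)) :=
  [/\ forall A, S A -> bounded_operator (pi A),
      linear_on S pi,
      multiplicative_on S pi,
      forall A, S A -> pi (adj A) = adj (pi A)
    & unital pi].

Definition l2norm H n (x : 'I_n -> H) : R :=
  Num.sqrt (\sum_(i < n) rnorm (x i) ^+ 2).

(* Norm of an operator matrix acting on the Hilbert sum of n copies of H. *)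
Definition mxopnorm H n (A : 'M[H -> H]_n) : R :=
  sup [set l2norm (fun i => \sum_(j < n) A i j (x j))
      | x in [set x : 'I_n -> H | l2norm x <= 1]].

Definition completely_contractive H K (S : set (H -> H))
    (phi : (H -> H) -> (K -> K)) :=
  [/\ forall A, S A -> bounded_operator (phi A),
      linear_on S phi
    & forall n (A : 'M[H -> H]_n), (0 < n)%N -> (forall i j, S (A i j)) ->
        mxopnorm (map_mx phi A) <= mxopnorm A].

Definition complete_isometry H K (S : set (H -> H))
    (phi : (H -> H) -> (K -> K)) :=
  [/\ forall A, S A -> bounded_operator (phi A),
      linear_on S phi
    & forall n (A : 'M[H -> H]_n), (0 < n)%N -> (forall i j, S (A i j)) ->
        mxopnorm (map_mx phi A) = mxopnorm A].

Definition commuting H d (T : 'I_d -> H -> H) :=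
  forall i j, T i \o T j = T j \o T i.

(* T_1 T_2 ... T_d *)
Definition opprod H d (T : 'I_d -> H -> H) : H -> H :=
  \big[(fun A B : H -> H => A \o B)/idfun]_(i < d) T i.

Definition sot_cvg H K (A : nat -> H -> K) (B : H -> K) :=
  forall x, A n x @[n --> \oo] --> B x.

Definition toeplitz H d (T : 'I_d -> H -> H) : set (H -> H) :=
  [set A | bounded_operator A /\ forall i, adj (T i) \o A \o T i = A].

Definition pseudo_extension H d (T : 'I_d -> H -> H)
    K (J : H -> K) (U : 'I_d -> K -> K) :=
  [/\ forall j, bounded_operator (U j),
      commuting U,
      contractive J,
      J <> (fun=> 0)
    & forall j, J \o T j = U j \o J].

Definition reducing K (M : set K) (A : K -> K) :=
  (forall x, M x -> M (A x)) /\ (forall x, M x -> M (adj A x)).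

Definition minimal_pseudo_extension H d (T : 'I_d -> H -> H)
    K (J : H -> K) (U : 'I_d -> K -> K) :=
  pseudo_extension T J U /\
  forall M : set K, linear_subspace M -> closed M ->
    (forall j, reducing M (U j)) -> range J `<=` M -> M = setT.

Definition canonical_pseudo_extension H d (T : 'I_d -> H -> H)
    K (J : H -> K) (U : 'I_d -> K -> K) :=
  minimal_pseudo_extension T J U /\
  sot_cvg (fun n => iter n (adj (opprod T)) \o iter n (opprod T)) (adj J \o J).

Definition pseudo_compression H K (J : H -> K) (Y : K -> K) : H -> H :=
  adj J \o Y \o J.

End operators.

(* Main.v *)
Require Import Defs.
From HB Require Import structures.
From mathcomp Require Import all_boot all_order all_algebra.
From mathcomp Require Import all_classical all_reals all_analysis.
From mathcomp Require Import complex lra ring.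

(** The proof rests on a concrete model of the space of the minimal unitary
    pseudo-extension, in which no completion and no quotient occur. Let [P] be
    the product of the contractions [T i] and let [K] consist of the bounded
    backward orbits of the adjoint of [P], i.e. of the bounded sequences [y] in
    [H] with [P^* y_(n+1) = y_n]. Along such a sequence the norms increase,
    because [P^*] is a contraction; their limit is a Hilbert norm on [K], whose
    inner product is the limit of the inner products of the entries. In the
    abstract picture [y_n] is [J^* W^n y], where [W] is the product of the
    unitaries and [J] the canonical map; here [W] is just the shift.

    The adjoints of the [T i] act entrywise on [K]. Their product acts as the
    inverse of the shift, which is isometric and onto, so each of these
    commuting contractions is itself isometric and onto ([coext_iso],
    [coext_surj]). The unitary [U i] is the adjoint of the [i]-th one, and [J]
    is the adjoint of evaluation at 0: it maps [x] to the sequence [Q P^n x],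
    where [Q = J^* J] is the strong limit of [P^*n P^n].

    Everything else follows from quantitative consequences of the monotonicity
    of the norms. Expanding squares gives
    - [|y_(m+k) - P^k y_m|^2 <= |y_(m+k)|^2 - |y_m|^2] ([gap_orbit]),
    - [|J y_n - W^n y|^2 <= |y|^2 - |y_n|^2] ([gap_shift]),
    and the right-hand sides tend to 0. The second estimate shows that [y] is
    the limit of [W^-n J y_n], whence minimality ([cano_minimal]).

    Say that [A] on [H] and [Y] on [K] are intertwined if [A y_n - (Y y)_n]
    tends to 0 for every [y] in [K]. As [|y_n|] tends to [|y|], such a [Y] is
    unique and depends contractively on [A], even for operator matrices
    ([intertwined_mx]); moreover intertwining is compatible with sums, products
    and norm limits. If [Y] commutes with the unitaries, then it is intertwined
    with its compression [J^* Y J] ([asymptotic_compression]). Conversely, if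
    [A] is Toeplitz, then [P^*m A y_(m+n)] is a Cauchy sequence in [m] by the
    first estimate, and its limits are the entries of [Y y] for an operator [Y]
    in the commutant of the unitaries with [J^* Y J = A]
    ([compression_toeplitz_lift]). Hence the operators that admit a symbol [Y]
    in the commutant, with adjoints intertwined as well, form a C*-algebra
    containing the identity and the Toeplitz operators
    ([symbol_algebra_cstar]), and [A |-> Y] is the representation [pi]. It is
    completely contractive and inverts the compression, which is completely
    contractive too; both are therefore completely isometric between the
    commutant and the Toeplitz operators ([compression_mx]). Finally [Q X] is
    Toeplitz when [X] commutes with the [T i], and its symbol is the lifting of
    [X] ([commutant_lift_cano], [commutant_lift_completely_contractive]). *)

Set Implicit Arguments.
Unset Strict Implicit.
Unset Printing Implicit Defensive.

Import Order.TTheory GRing.Theory Num.Theory.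
Import numFieldNormedType.Exports.

Local Open Scope classical_set_scope.
Local Open Scope ring_scope.
Local Open Scope complex_scope.

(** * The real inner product of a Hilbert space *)

Section RealInnerProduct.
Context {R : realType}.
Implicit Types H : hilbertType R.

Lemma ReD (z w : R[i]) : complex.Re (z + w) = complex.Re z + complex.Re w.
Proof. by case: z w => [a b] [c e]. Qed.

Lemma ReN (z : R[i]) : complex.Re (- z) = - complex.Re z.
Proof. by case: z. Qed.

Lemma ReZ (c : R) (z : R[i]) : complex.Re (c%:C * z) = c * complex.Re z.
Proof. by case: z => a b /=; rewrite mul0r subr0. Qed.

Lemma normcRe (a : R[i]) : `|a| = (complex.Re `|a|)%:C.
Proof. by rewrite RRe_real// ger0_real. Qed.

Lemma normcRe_ge0 (a : R[i]) : 0 <= complex.Re `|a|.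
Proof. by have := normr_ge0 a; rewrite lecE => /andP[]. Qed.

Lemma innerC H (x y : H) : inner y x = (inner x y)^*.
Proof. rewrite [LHS]hermC expr0 mul1r; exact: erefl. Qed.

(** Norms, convergence and adjoints only involve the real part of the inner
    product; working with it keeps all estimates in the ordered field [R]. *)
Definition rin H (x y : H) : R := complex.Re (inner x y).

Lemma innerZl H (a : R[i]) (x y : H) : inner (a *: x) y = a * inner x y.
Proof. exact: linearZl_LR. Qed.

Lemma innerZr H (a : R[i]) (x y : H) : inner x (a *: y) = a^* * inner x y.
Proof. by rewrite innerC innerZl rmorphM/= -innerC. Qed.

Lemma rinC H (x y : H) : rin x y = rin y x.
Proof. by rewrite /rin innerC; case: (inner y x). Qed.

Lemma rinDl H (x y z : H) : rin (x + y) z = rin x z + rin y z.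
Proof. by rewrite /rin linearDl ReD. Qed.

Lemma rinNl H (x z : H) : rin (- x) z = - rin x z.
Proof. by rewrite /rin linearNl ReN. Qed.

Lemma rinBl H (x y z : H) : rin (x - y) z = rin x z - rin y z.
Proof. by rewrite rinDl rinNl. Qed.

Lemma rinZl H (c : R) (x y : H) : rin (c%:C *: x) y = c * rin x y.
Proof. by rewrite /rin innerZl ReZ. Qed.

Lemma rin0l H (z : H) : rin 0 z = 0.
Proof. by rewrite -[0](subrr (0 : H)) rinBl subrr. Qed.

Lemma rin0r H (z : H) : rin z 0 = 0.
Proof. by rewrite rinC rin0l. Qed.

Lemma rinDr H (x y z : H) : rin x (y + z) = rin x y + rin x z.
Proof. by rewrite !(rinC x) rinDl. Qed.

Lemma rinNr H (x z : H) : rin x (- z) = - rin x z.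
Proof. by rewrite !(rinC x) rinNl. Qed.

Lemma rinBr H (x y z : H) : rin x (y - z) = rin x y - rin x z.
Proof. by rewrite rinDr rinNr. Qed.

Lemma rinZr H (c : R) (x y : H) : rin x (c%:C *: y) = c * rin x y.
Proof. by rewrite !(rinC x) rinZl. Qed.

(** The imaginary part of a complex inner product is again a real inner product,
    so that complex identities reduce to identities for [rin]. *)
Lemma innerE H (x y : H) : inner x y = rin x y +i* rin x ('i *: y).
Proof.
rewrite /rin innerZr; case: (inner x y) => a b /=; congr (_ +i* _).
by rewrite mul0r sub0r mulN1r opprK.
Qed.

Lemma rnorm_ge0 H (x : H) : 0 <= rnorm x.
Proof. by have := normr_ge0 x; rewrite lecE => /andP[]. Qed.

Lemma normE H (x : H) : `|x| = (rnorm x)%:C.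
Proof. by rewrite /rnorm RRe_real// ger0_real. Qed.

Lemma rnorm_sqr H (x : H) : rnorm x ^+ 2 = rin x x.
Proof. by rewrite /rin -inner_normE normE -rmorphXn. Qed.

Lemma rnorm0 H : rnorm (0 : H) = 0.
Proof. by rewrite /rnorm normr0. Qed.

Lemma rnorm0_eq0 H (x : H) : rnorm x = 0 -> x = 0.
Proof. by move=> x0; apply/normr0_eq0; rewrite normE x0. Qed.

Lemma rnormN H (x : H) : rnorm (- x) = rnorm x.
Proof. by rewrite /rnorm normrN. Qed.

Lemma rnormBC H (x y : H) : rnorm (x - y) = rnorm (y - x).
Proof. by rewrite -rnormN opprB. Qed.

Lemma ler_rnormD H (x y : H) : rnorm (x + y) <= rnorm x + rnorm y.
Proof. by rewrite -lecR rmorphD/= -!normE ler_normD. Qed.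

Lemma ler_rnormB H (x y z : H) : rnorm (x - z) <= rnorm (x - y) + rnorm (y - z).
Proof. by rewrite -[x - z](subrKA y) ler_rnormD. Qed.

Lemma rnormZ H (a : R[i]) (x : H) :
  rnorm (a *: x) = complex.Re `|a| * rnorm x.
Proof.
by rewrite {1}/rnorm normrZ normE mulrC ReZ mulrC.
Qed.

Lemma rnormZr H (c : R) (x : H) : rnorm (c%:C *: x) = `|c| * rnorm x.
Proof.
by rewrite rnormZ; congr (_ * _); rewrite normc_def/= expr0n/= addr0 sqrtr_sqr.
Qed.

Lemma rnormD_sqr H (x y : H) :
  rnorm (x + y) ^+ 2 = rnorm x ^+ 2 + 2 * rin x y + rnorm y ^+ 2.
Proof. by rewrite !rnorm_sqr !(rinDl, rinDr) (rinC y); lra. Qed.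

Lemma rnormB_sqr H (x y : H) :
  rnorm (x - y) ^+ 2 = rnorm x ^+ 2 - 2 * rin x y + rnorm y ^+ 2.
Proof. by rewrite rnormD_sqr rnormN rinNr; lra. Qed.

Lemma parallelogram H (x y : H) :
  rnorm (x - y) ^+ 2 = 2 * rnorm x ^+ 2 + 2 * rnorm y ^+ 2 - rnorm (x + y) ^+ 2.
Proof. by rewrite rnormB_sqr rnormD_sqr; lra. Qed.

Lemma rin_eq H (x y : H) : (forall z, rin z x = rin z y) -> x = y.
Proof.
move=> xy; apply/eqP; rewrite -subr_eq0; apply/eqP/rnorm0_eq0/eqP.
by rewrite -sqrf_eq0 rnorm_sqr rinBr xy subrr.
Qed.

(** Cauchy-Schwarz, by expanding the square of [|y| x - |x| y]. *)
Lemma rin_le H (x y : H) : rin x y <= rnorm x * rnorm y.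
Proof.
have [/rnorm0_eq0 ->|x0] := eqVneq (rnorm x) 0.
  by rewrite rin0l mulr_ge0 ?rnorm_ge0.
have {x0}x0 : 0 < rnorm x by rewrite lt_neqAle eq_sym x0 rnorm_ge0.
have := sqr_ge0 (rnorm ((rnorm y)%:C *: x - (rnorm x)%:C *: y)).
rewrite rnormB_sqr rinZl rinZr !rnormZr !ger0_norm ?rnorm_ge0//.
move=> h; have [/rnorm0_eq0 ->|y0] := eqVneq (rnorm y) 0.
  by rewrite rin0r mulr_ge0 ?rnorm_ge0.
have {}y0 : 0 < rnorm y by rewrite lt_neqAle eq_sym y0 rnorm_ge0.
have xy : 0 < rnorm x * rnorm y by rewrite mulr_gt0.
rewrite -(ler_pM2l xy); nra.
Qed.

Lemma abs_rin_le H (x y : H) : `|rin x y| <= rnorm x * rnorm y.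
Proof.
rewrite ler_norml rin_le andbT lerNl -rinNl.
by rewrite (le_trans (rin_le _ _))// rnormN.
Qed.

Lemma abs_rnormB H (x y : H) : `|rnorm x - rnorm y| <= rnorm (x - y).
Proof.
rewrite ler_norml lerNl opprB !lerBlDr; apply/andP; split.
  by rewrite rnormBC (le_trans _ (ler_rnormD _ _))// subrK.
by rewrite (le_trans _ (ler_rnormD _ _))// subrK.
Qed.

End RealInnerProduct.

(** * Convergence and completeness *)

Section Convergence.
Context {R : realType}.
Implicit Types H K : hilbertType R.

Lemma cvg_rnormBP H (I : Type) (F : set_system I) {FF : Filter F}
    (u : I -> H) (l : H) :
  u x @[x --> F] --> l <-> rnorm (u x - l) @[x --> F] --> (0 : R).
Proof.
split=> [ul|ul].
- apply/cvgr0Pnorm_lt => e e0.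
  have e0' : (0 : R[i]) < e%:C by rewrite ltcR.
  move/cvgrPdist_lt/(_ _ e0'): ul; apply: filterS => x.
  by rewrite distrC normE ltcR ger0_norm ?rnorm_ge0.
- apply/cvgrPdist_lt => e e0.
  have e0' : 0 < complex.Re e by move: e0; rewrite ltcE => /andP[].
  move/cvgr0Pnorm_lt/(_ _ e0'): ul; apply: filterS => x.
  rewrite distrC normE ger0_norm ?rnorm_ge0// ltcE/=.
  by move: e0; rewrite ltcE => /andP[/eqP ->] _ ->; rewrite eqxx.
Qed.

Lemma limR_unique (I : Type) (F : set_system I) {FF : ProperFilter F}
    (f : I -> R) (l m : R) :
  f x @[x --> F] --> l -> f x @[x --> F] --> m -> l = m.
Proof. by move=> fl fm; apply: (@cvg_unique R (@Rhausdorff R) (f @ F)). Qed.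

Lemma limH_unique H (I : Type) (F : set_system I) {FF : ProperFilter F}
    (f : I -> H) (l m : H) :
  f x @[x --> F] --> l -> f x @[x --> F] --> m -> l = m.
Proof.
by move=> fl fm; apply: (@cvg_unique H (@norm_hausdorff _ H) (f @ F)).
Qed.

Lemma squeeze0 (I : Type) (F : set_system I) {FF : Filter F} (f g : I -> R) :
  (forall x, 0 <= f x <= g x) ->
  g x @[x --> F] --> (0 : R) -> f x @[x --> F] --> (0 : R).
Proof.
move=> fg g0; apply: (@squeeze_cvgr _ _ _ _ (fun=> 0) g f) => //; last exact: cvg_cst.
exact: nearW.
Qed.

Lemma cvg_sqr0 (I : Type) (F : set_system I) {FF : Filter F} (f : I -> R) :
  (forall x, 0 <= f x) -> f x ^+ 2 @[x --> F] --> (0 : R) ->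
  f x @[x --> F] --> (0 : R).
Proof.
move=> f0 /cvgr0Pnorm_lt h; apply/cvgr0Pnorm_lt => e e0.
apply: filterS (h _ (exprn_gt0 2 e0)) => x.
by rewrite normrX ltr_pXn2r// nnegrE ltW.
Qed.

Lemma cvg_sqr (I : Type) (F : set_system I) {FF : Filter F} (f : I -> R) (l : R) :
  f x @[x --> F] --> l -> f x ^+ 2 @[x --> F] --> l ^+ 2.
Proof. by move=> fl; exact: (cvgM fl fl). Qed.

Lemma cvg_rnorm H (I : Type) (F : set_system I) {FF : Filter F}
    (u : I -> H) (l : H) :
  u x @[x --> F] --> l -> rnorm (u x) @[x --> F] --> rnorm l.
Proof.
move=> /cvg_rnormBP ul; apply/subr_cvg0/norm_cvg0P.
by apply: squeeze0 ul => x; rewrite normr_ge0 abs_rnormB.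
Qed.

(** The modulus bounds the square of the distance because all Cauchy estimates
    below come from expanding squares. *)
Lemma cauchy_modulus H (u : nat -> H) (e : nat -> R) :
  (forall m k, rnorm (u (m + k)%N - u m) ^+ 2 <= e m) ->
  e n @[n --> \oo] --> (0 : R) -> cvgn u.
Proof.
move=> ue e0; apply: cauchy_cvg; apply: cauchy_exP => d d0.
have d0' : 0 < complex.Re d by move: d0; rewrite ltcE => /andP[].
have [m _ me] : \forall m \near \oo, `|e m| < complex.Re d ^+ 2.
  by move/cvgr0Pnorm_lt: e0; apply; rewrite exprn_gt0.
exists (u m); exists m => // n /= mn.
rewrite -ball_normE/= distrC normE ltcE/=.
move: d0; rewrite ltcE => /andP[/eqP -> _]; rewrite eqxx/=.
rewrite -(subnKC mn) -(@ltr_pXn2r _ 2)// ?nnegrE ?rnorm_ge0 ?(ltW d0')//.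
apply: (le_lt_trans (ue _ _)).
by apply: le_lt_trans (me m _); rewrite ?ler_norm//=.
Qed.

Lemma rin_polar H (x y : H) :
  rin x y = 4^-1 * (rnorm (x + y) ^+ 2 - rnorm (x - y) ^+ 2).
Proof. by rewrite rnormB_sqr rnormD_sqr; lra. Qed.

Lemma cvg_rin H (I : Type) (F : set_system I) {FF : Filter F}
    (u v : I -> H) (l m : H) :
  u x @[x --> F] --> l -> v x @[x --> F] --> m ->
  rin (u x) (v x) @[x --> F] --> rin l m.
Proof.
move=> ul vm; rewrite rin_polar; under eq_fun do rewrite rin_polar.
apply: cvgM; first exact: cvg_cst.
apply: cvgB; apply: cvg_sqr; apply: cvg_rnorm; first exact: cvgD.
exact: cvgB.
Qed.

End Convergence.

(** * Bounded operators, the Riesz theorem and adjoints *)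

Section Operators.
Context {R : realType}.
Implicit Types H K L : hilbertType R.

Section LinearMaps.
Context {H K : hilbertType R} {A : H -> K}.
Hypothesis linA : linear A.

Lemma linD x y : A (x + y) = A x + A y.
Proof. by have := linA 1 x y; rewrite !scale1r. Qed.

Lemma lin0 : A 0 = 0.
Proof. by apply: (@addIr _ (A 0)); rewrite -linD !add0r. Qed.

Lemma linZ a x : A (a *: x) = a *: A x.
Proof. by have := linA a x 0; rewrite !addr0 lin0 addr0. Qed.

Lemma linN x : A (- x) = - A x.
Proof. by rewrite -scaleN1r linZ scaleN1r. Qed.

Lemma linB x y : A (x - y) = A x - A y.
Proof. by rewrite linD linN. Qed.

Lemma lin_sum (I : Type) (r : seq I) (F : I -> H) :
  A (\sum_(i <- r) F i) = \sum_(i <- r) A (F i).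
Proof. by apply: (big_morph A) => [x y|]; [rewrite linD|rewrite lin0]. Qed.

Lemma lin_bounded_cvg (M : R) (I : Type) (F : set_system I) {FF : Filter F}
    (u : I -> H) (l : H) :
  (forall x, rnorm (A x) <= M * rnorm x) ->
  u x @[x --> F] --> l -> A (u x) @[x --> F] --> A l.
Proof.
move=> AM /cvg_rnormBP ul; apply/cvg_rnormBP.
apply: (@squeeze0 _ _ _ _ _ (fun x => M * rnorm (u x - l))) => [x|].
  by rewrite rnorm_ge0 -linB AM.
by rewrite -(mulr0 M); apply: cvgM => //; apply: cvg_cst.
Qed.

End LinearMaps.

Lemma bounded_lin H K (A : H -> K) : bounded_operator A -> linear A.
Proof. by case. Qed.

Lemma bounded_cvg H K (A : H -> K) (I : Type) (F : set_system I) {FF : Filter F}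
    (u : I -> H) (l : H) : bounded_operator A ->
  u x @[x --> F] --> l -> A (u x) @[x --> F] --> A l.
Proof. by move=> [linA [M AM]]; apply: lin_bounded_cvg AM. Qed.

Lemma unit_ball_image H K (A : H -> K) (M : R) : linear A ->
  (forall x, rnorm x <= 1 -> rnorm (A x) <= M) ->
  forall x, rnorm (A x) <= M * rnorm x.
Proof.
move=> linA AM x; have [x0|x0] := eqVneq (rnorm x) 0.
  by rewrite x0 (rnorm0_eq0 x0) (lin0 linA) rnorm0 mulr0.
have {}x0 : 0 < rnorm x by rewrite lt_neqAle eq_sym x0 rnorm_ge0.
have := AM ((rnorm x)^-1%:C *: x).
rewrite (linZ linA) !rnormZr ger0_norm ?invr_ge0 ?(ltW x0)//.
rewrite mulVf ?gt_eqF// => /(_ (lexx _)).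
by rewrite mulrC ler_pdivrMr.
Qed.

Lemma opnorm_has_ubound H K (A : H -> K) : bounded_operator A ->
  has_ubound [set rnorm (A x) | x in [set x | rnorm x <= 1]].
Proof.
move=> [linA [M AM]]; exists `|M| => _ [z z1 <-]; rewrite (le_trans (AM z))//.
rewrite (le_trans (ler_wpM2r (rnorm_ge0 _) (ler_norm M)))//.
by rewrite ler_piMr.
Qed.

Lemma opnorm_ub H K (A : H -> K) : bounded_operator A ->
  forall x, rnorm (A x) <= opnorm A * rnorm x.
Proof.
move=> bA; apply: unit_ball_image => [|x x1]; first exact: bounded_lin.
by apply: ub_le_sup; [exact: opnorm_has_ubound|exists x].
Qed.

Lemma opnorm_ge0 H K (A : H -> K) : bounded_operator A -> 0 <= opnorm A.
Proof.
move=> bA; apply: le_trans (rnorm_ge0 (A 0)) _; apply: ub_le_sup.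
  exact: opnorm_has_ubound.
by exists 0; rewrite //= rnorm0.
Qed.

Lemma opnorm_le H K (A : H -> K) (M : R) :
  (forall x, rnorm x <= 1 -> rnorm (A x) <= M) -> opnorm A <= M.
Proof.
move=> AM; apply: ge_sup.
  by exists (rnorm (A 0)); exists 0 => //=; rewrite rnorm0.
by move=> _ [x x1 <-]; exact: AM.
Qed.

Lemma contractiveP H K (A : H -> K) :
  contractive A <-> linear A /\ forall x, rnorm (A x) <= rnorm x.
Proof.
split=> [[bA A1]|[linA A1]].
  split=> [|x]; first exact: bounded_lin.
  by rewrite (le_trans (opnorm_ub bA x))// ler_piMl// rnorm_ge0.
split; first by split=> //; exists 1 => x; rewrite mul1r.
by apply: opnorm_le => x; apply: le_trans.
Qed.

Lemma bounded_comp H K L (A : K -> L) (B : H -> K) :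
  bounded_operator A -> bounded_operator B -> bounded_operator (A \o B).
Proof.
move=> bA bB; split=> [a x y/=|].
  by rewrite (bounded_lin bB) (bounded_lin bA).
exists (opnorm A * opnorm B) => x /=.
rewrite (le_trans (opnorm_ub bA _))// -mulrA ler_wpM2l ?opnorm_ge0//.
exact: opnorm_ub.
Qed.

Lemma bounded_id H : bounded_operator (@idfun H).
Proof. by split=> //; exists 1 => x; rewrite mul1r. Qed.

Lemma lincombE H K (a : R[i]) (A B : H -> K) x :
  (a *: A + B) x = a *: A x + B x.
Proof. by []. Qed.

Lemma bounded_lincomb H K (a : R[i]) (A B : H -> K) :
  bounded_operator A -> bounded_operator B -> bounded_operator (a *: A + B).
Proof.
move=> bA bB; split=> [c x y|].
  rewrite !lincombE (bounded_lin bB) (bounded_lin bA).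
  by rewrite !scalerDr !scalerA (mulrC a) addrACA.
exists (complex.Re `|a| * opnorm A + opnorm B) => x /=.
rewrite mulrDl (le_trans (ler_rnormD _ _))// lerD ?opnorm_ub//.
by rewrite rnormZ -mulrA ler_wpM2l ?opnorm_ub ?normcRe_ge0//.
Qed.

(** Riesz: [rnorm x ^+ 2 - 2 * f x] is bounded below, a minimizing sequence is
    fundamental by the parallelogram law, and the first variation vanishes at
    its limit. *)
Lemma riesz H (f : H -> R) (M : R) :
  {morph f : x y / x + y} -> (forall (c : R) x, f (c%:C *: x) = c * f x) ->
  (forall x, `|f x| <= M * rnorm x) -> exists z, forall x, f x = rin x z.
Proof.
move=> fD fZ fM; pose g x := rnorm x ^+ 2 - 2 * f x.
have g_ge x : - M ^+ 2 <= g x.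
  have := fM x; rewrite ler_norml => /andP[_ fx].
  by have := sqr_ge0 (rnorm x - M); rewrite /g; nra.
have gE : has_inf (range g).
  by split; [exists (g 0), 0|exists (- M ^+ 2) => _ [x _ <-]].
pose m := inf (range g).
have mg x : m <= g x by apply: ge_inf; [case: gE|exists x].
have /choice[u um] n : exists x, g x < m + n.+1%:R^-1.
  have [|_ [x _ <-] gx] := @inf_adherent R (range g) n.+1%:R^-1 _ gE.
    by rewrite invr_gt0.
  by exists x.
have gD x y : rnorm (x - y) ^+ 2 <= 2 * (g x - m) + 2 * (g y - m).
  (* the midpoint of x and y is also a competitor in the infimum *)
  have := mg (2^-1%:C *: (x + y)).
  rewrite /g rnormZr fZ fD exprMn ger0_norm ?invr_ge0//.
  by rewrite parallelogram; lra.
have e0 : (4 : R) * n.+1%:R^-1 @[n --> \oo] --> (0 : R).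
  by rewrite -(mulr0 4); apply: cvgM; [exact: cvg_cst|exact: cvg_harmonic].
have /cvg_ex[z uz] : cvgn u.
  apply: cauchy_modulus e0 => p k; rewrite (le_trans (gD _ _))//.
  have h1 := um p; have h2 := um (p + k)%N.
  have : ((p + k).+1%:R^-1 : R) <= p.+1%:R^-1.
    by rewrite lef_pV2 ?posrE ?ltr0n// ler_nat ltnS leq_addr.
  move: h1 h2; move: (p.+1%:R^-1) ((p + k).+1%:R^-1) => r s; lra.
have gz : g z <= m.
  have gu : g (u n) @[n --> \oo] --> g z.
    apply: cvgB.
      by apply: cvg_sqr; apply: cvg_rnorm.
    apply: cvgM; first exact: cvg_cst.
    have fB x y : f (x - y) = f x - f y.
      rewrite fD -[in f (- y)]scaleN1r; congr (_ + _).
      by have := fZ (-1) y; rewrite rmorphN1 mulN1r.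
    apply/subr_cvg0/norm_cvg0P; move/cvg_rnormBP: uz => uz.
    apply: (@squeeze0 _ _ _ _ _ (fun n => M * rnorm (u n - z))) => [x|].
      by rewrite normr_ge0 -fB fM.
    by rewrite -(mulr0 M); apply: cvgM => //; apply: cvg_cst.
  have mm : m + n.+1%:R^-1 @[n --> \oo] --> m.
    by rewrite -[X in _ --> X]addr0; apply: cvgD; [exact: cvg_cst|exact: cvg_harmonic].
  by apply: ler_cvg_to gu mm _; apply: nearW => n; rewrite ltW.
exists z => x; set b := rin x z - f x; set a := rnorm x ^+ 2.
have a0 : 0 <= a by rewrite sqr_ge0.
have var t : 0 <= t ^+ 2 * a + 2 * t * b.
  have := le_trans gz (mg (z + t%:C *: x)).
  rewrite /g rnormD_sqr rnormZr exprMn real_normK ?num_real// rinZr fD fZ.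
  by rewrite (rinC z) -/a /b; lra.
suff : b = 0 by rewrite /b; lra.
(* the minimizer - b / a of the parabola, made safe against a = 0 *)
have := var (- b / (a + 1)).
have a1 : 0 < a + 1 by rewrite ltr_pwDr.
have -> : (- b / (a + 1)) ^+ 2 * a + 2 * (- b / (a + 1)) * b =
  - (b ^+ 2 * ((a + 2) / (a + 1) ^+ 2)).
  by field; rewrite gt_eqF.
rewrite oppr_ge0 pmulr_lle0; last by rewrite divr_gt0 ?exprn_gt0// ltr_wpDl.
move=> b2; apply/eqP; rewrite -sqrf_eq0; apply/eqP.
by apply/le_anti; rewrite b2 sqr_ge0.
Qed.

(** For a complex-linear [A], testing against ['i *: x] recovers the imaginary
    parts. *)
Lemma inner_of_rin H K (A : H -> K) (B : K -> H) : linear A ->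
  (forall x y, rin (A x) y = rin x (B y)) ->
  (forall x y, inner (A x) y = inner x (B y)).
Proof.
move=> linA AB x y; rewrite innerE [RHS]innerE AB; congr (_ +i* _).
have riI (L : hilbertType R) (u v : L) : rin u ('i *: v) = - rin ('i *: u) v.
  by rewrite /rin innerZl innerZr; case: (inner u v) => a b /=; lra.
by rewrite !riI -(linZ linA) AB.
Qed.

Lemma adj_exists H K (A : H -> K) : bounded_operator A ->
  exists B, forall x y, rin (A x) y = rin x (B y).
Proof.
move=> bA; suff /choice[B BA] : forall y, exists z, forall x, rin (A x) y = rin x z.
  by exists B => x y; exact: BA.
move=> y; have linA := bounded_lin bA.
apply: (@riesz _ (fun x => rin (A x) y) (opnorm A * rnorm y)) => [u v|c x|x].
- by rewrite (linD linA) rinDl.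
- by rewrite (linZ linA) rinZl.
- rewrite (le_trans (abs_rin_le _ _))// mulrAC ler_wpM2r ?rnorm_ge0//.
  exact: opnorm_ub.
Qed.

(** Identifies an adjoint without invoking the Riesz theorem. *)
Lemma adjP H K (A : H -> K) (B : K -> H) : linear A ->
  (forall x y, rin (A x) y = rin x (B y)) -> adj A = B.
Proof.
move=> linA AB; apply/funext => y; apply: xget_unique.
  by move=> x; exact: inner_of_rin.
by move=> z zA; apply: rin_eq => x; rewrite /rin -zA -/(rin _ _) AB.
Qed.

Section AdjointOf.
Context {H K : hilbertType R} {A : H -> K}.
Hypothesis bA : bounded_operator A.

Lemma rin_adj x y : rin (A x) y = rin x (adj A y).
Proof.
have [B AB] := adj_exists bA.
by rewrite (adjP (bounded_lin bA) AB) AB.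
Qed.

Lemma rin_adjr x y : rin x (A y) = rin (adj A x) y.
Proof. by rewrite rinC rin_adj rinC. Qed.

Lemma adj_lin : linear (adj A).
Proof.
have linA := bounded_lin bA.
move=> a x y; apply: rin_eq => z.
have AE : inner z (adj A (a *: x + y)) = inner z (a *: adj A x + adj A y).
  have AI := inner_of_rin linA rin_adj.
  by rewrite -AI linearDr [in RHS]linearDr /= !innerZr !AI.
by rewrite /rin AE.
Qed.

Lemma adj_ub (M : R) : 0 <= M -> (forall x, rnorm (A x) <= M * rnorm x) ->
  forall y, rnorm (adj A y) <= M * rnorm y.
Proof.
move=> M0 AM y; have [->|y0] := eqVneq (rnorm (adj A y)) 0.
  by rewrite mulr_ge0 ?rnorm_ge0.
have {}y0 : 0 < rnorm (adj A y) by rewrite lt_neqAle eq_sym y0 rnorm_ge0.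
rewrite -(ler_pM2l y0) -expr2 rnorm_sqr -rin_adj (le_trans (rin_le _ _))//.
by rewrite (le_trans (ler_wpM2r (rnorm_ge0 _) (AM _)))// -mulrA mulrCA.
Qed.

Lemma adj_bounded : bounded_operator (adj A).
Proof.
split; first exact: adj_lin.
exists (opnorm A); apply: adj_ub; first exact: opnorm_ge0.
exact: opnorm_ub.
Qed.

Lemma adjK : adj (adj A) = A.
Proof. by apply: (adjP adj_lin) => x y; rewrite rin_adjr. Qed.

End AdjointOf.

Lemma adj_comp H K L (A : K -> L) (B : H -> K) :
  bounded_operator A -> bounded_operator B ->
  adj (A \o B) = adj B \o adj A.
Proof.
move=> bA bB; apply: adjP => [|x y /=]; last by rewrite !rin_adj.
by apply: bounded_lin; apply: bounded_comp.
Qed.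

Lemma adj_id H : adj (@idfun H) = idfun.
Proof. exact: adjP. Qed.

Lemma adj_lincomb H K (a : R[i]) (A B : H -> K) :
  bounded_operator A -> bounded_operator B ->
  adj (a *: A + B) = a^* *: adj A + adj B.
Proof.
move=> bA bB; apply: adjP => [|x y].
  by apply: bounded_lin; apply: bounded_lincomb.
have E : inner (a *: A x + B x) y = inner x (a^* *: adj A y + adj B y).
  have AI := inner_of_rin (bounded_lin bA) (rin_adj bA).
  have BI := inner_of_rin (bounded_lin bB) (rin_adj bB).
  rewrite linearDl [in RHS]linearDr /= innerZl innerZr AI BI.
  by congr (_ * _ + _); symmetry; exact: conjcK.
exact: (congr1 (@complex.Re R) E).
Qed.

End Operators.

(** * The Hilbert space of bounded backward orbits *)

Section ComplexLimits.
Context {R : realType}.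

(** Convergence in [R[i]], kept componentwise so that only real limits are
    taken. *)
Definition ccvg (f : nat -> R[i]) (l : R[i]) :=
  complex.Re (f n) @[n --> \oo] --> complex.Re l /\
  complex.Im (f n) @[n --> \oo] --> complex.Im l.

Lemma ccvg_unique f l m : ccvg f l -> ccvg f m -> l = m.
Proof.
move=> [Rl Il] [Rm Im]; apply/eqP.
by rewrite eq_complex (limR_unique Rl Rm) (limR_unique Il Im) !eqxx.
Qed.

Lemma ccvgJ f l : ccvg f l -> ccvg (fun n => (f n)^*) l^*.
Proof.
move=> [Rl Il]; split.
  rewrite (_ : (fun n => _) = fun n => complex.Re (f n)).
    by case: l Rl {Il}.
  by apply/funext => n; case: (f n).
rewrite (_ : (fun n => _) = fun n => - complex.Im (f n)).
  by case: l Il {Rl} => a b /= Il; apply: cvgN.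
by apply/funext => n; case: (f n).
Qed.

Lemma ccvgP a f g l m : ccvg f l -> ccvg g m ->
  ccvg (fun n => a * f n + g n) (a * l + m).
Proof.
move=> [Rl Il] [Rm Im]; split.
  rewrite (_ : (fun n => _) = fun n => complex.Re a * complex.Re (f n) -
      complex.Im a * complex.Im (f n) + complex.Re (g n)).
    rewrite (_ : complex.Re (a * l + m) = complex.Re a * complex.Re l -
        complex.Im a * complex.Im l + complex.Re m); last first.
      by case: a l m {Rl Il Rm Im} => [? ?] [? ?] [? ?].
    by apply: cvgD => //; apply: cvgB; apply: cvgM => //; exact: cvg_cst.
  by apply/funext => n; case: a (f n) (g n) => [? ?] [? ?] [? ?].
rewrite (_ : (fun n => _) = fun n => complex.Re a * complex.Im (f n) +
    complex.Im a * complex.Re (f n) + complex.Im (g n)).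
  rewrite (_ : complex.Im (a * l + m) = complex.Re a * complex.Im l +
      complex.Im a * complex.Re l + complex.Im m); last first.
    by case: a l m {Rl Il Rm Im} => [? ?] [? ?] [? ?].
  by apply: cvgD => //; apply: cvgD; apply: cvgM => //; exact: cvg_cst.
by apply/funext => n; case: a (f n) (g n) => [? ?] [? ?] [? ?].
Qed.

End ComplexLimits.

(** Bundled so that the orbit space depends on a single argument. *)
Record contrOperator (R : realType) (H : hilbertType R) :=
  ContrOperator { cfun :> H -> H ; cfunP : contractive cfun }.

Section BackwardOrbits.
Context {R : realType} {H : hilbertType R} (C : contrOperator H).

Lemma cfun_lin : linear C.
Proof. by case/contractiveP: (cfunP C). Qed.

Lemma cfun_le x : rnorm (C x) <= rnorm x.
Proof. by case/contractiveP: (cfunP C). Qed.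

Lemma cfun_bounded : bounded_operator C.
Proof. by case: (cfunP C). Qed.

Definition backward : {pred nat -> H} :=
  [pred y : nat -> H | `[< (forall n, C (y n.+1) = y n) /\
                         exists M : R, forall n, rnorm (y n) <= M >]].

Lemma backward_submod_closed : submod_closed backward.
Proof.
split.
  apply/asboolP; split=> [n|]; first exact: lin0 cfun_lin.
  by exists 0 => n; rewrite rnorm0.
move=> a y z /asboolP[yC [M yM]] /asboolP[zC [N zN]]; apply/asboolP; split=> [n|].
  by have := cfun_lin a (y n.+1) (z n.+1); rewrite yC zC.
exists (complex.Re `|a| * M + N) => n.
rewrite [X in rnorm X](_ : _ = a *: y n + z n)// (le_trans (ler_rnormD _ _))// lerD//.
by rewrite rnormZ ler_wpM2l ?normcRe_ge0.
Qed.

HB.instance Definition _ :=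
  GRing.isSubmodClosed.Build _ _ backward backward_submod_closed.

Record orbitSpace := Orbit { ev :> nat -> H; _ : ev \in backward }.

HB.instance Definition _ := [isSub for ev].
HB.instance Definition _ := [Choice of orbitSpace by <:].
HB.instance Definition _ := [SubChoice_isSubLmodule of orbitSpace by <:].

Implicit Types y z : orbitSpace.

Lemma orbitS y n : C (y n.+1) = y n.
Proof. by have /asboolP[] := valP y. Qed.

Lemma orbitP y z : (forall n, y n = z n) -> y = z.
Proof. by move=> yz; apply: val_inj; apply/funext. Qed.

Lemma evD y z n : (y + z) n = y n + z n. Proof. by []. Qed.
Lemma evZ a y n : (a *: y) n = a *: y n. Proof. by []. Qed.
Lemma evB y z n : (y - z) n = y n - z n. Proof. by []. Qed.
Lemma ev0 n : (0 : orbitSpace) n = 0. Proof. by []. Qed.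

(** The supremum is the limit, as the norms of the entries increase. *)
Definition onorm y : R := sup (range (fun n => rnorm (y n))).

Lemma orbit_has_ubound y : has_ubound (range (fun n => rnorm (y n))).
Proof.
have /asboolP[_ [M yM]] := valP y.
by exists M => _ [n _ <-]; exact: yM.
Qed.

Lemma rnorm_ev_le y n : rnorm (y n) <= onorm y.
Proof. by apply: ub_le_sup; [exact: orbit_has_ubound|exists n]. Qed.

Lemma onorm_le y (M : R) : (forall n, rnorm (y n) <= M) -> onorm y <= M.
Proof.
by move=> yM; apply: ge_sup; [exists (rnorm (y 0)), 0|move=> _ [n _ <-]].
Qed.

Lemma rnorm_ev_homo y :
  {homo (fun n => rnorm (y n)) : m n / (m <= n)%N >-> m <= n}.
Proof.
by apply: homo_leq => [//|? ? ?|n]; [exact: le_trans|rewrite -orbitS cfun_le].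
Qed.

Lemma cvg_onorm y : rnorm (y n) @[n --> \oo] --> onorm y.
Proof.
by apply: nondecreasing_cvgn; [exact: rnorm_ev_homo|exact: orbit_has_ubound].
Qed.

Lemma onormD y z : onorm (y + z) <= onorm y + onorm z.
Proof.
apply: onorm_le => n; rewrite evD (le_trans (ler_rnormD _ _))//.
by rewrite lerD ?rnorm_ev_le.
Qed.

Lemma onormZ a y : onorm (a *: y) = complex.Re `|a| * onorm y.
Proof.
apply: (limR_unique (cvg_onorm (y := a *: y))).
under eq_fun do rewrite evZ rnormZ.
by apply: cvgM; [exact: cvg_cst|exact: cvg_onorm].
Qed.

Lemma onorm_eq0 y : onorm y = 0 -> y = 0.
Proof.
move=> y0; apply: orbitP => n; rewrite ev0; apply: rnorm0_eq0.
by apply/le_anti; rewrite rnorm_ge0 -y0 rnorm_ev_le.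
Qed.

Let cnorm y : R[i] := (onorm y)%:C.

Let cnormD y z : cnorm (y + z) <= cnorm y + cnorm z.
Proof. by rewrite -rmorphD lecR onormD. Qed.

Let cnormZ a y : cnorm (a *: y) = `|a| * cnorm y.
Proof. by rewrite /cnorm onormZ [in RHS]normcRe -rmorphM. Qed.

Let cnorm_eq0 y : cnorm y = 0 -> y = 0.
Proof. by move=> /(congr1 (@complex.Re R))/= /onorm_eq0. Qed.

HB.instance Definition _ :=
  Lmodule_isNormed.Build R[i] orbitSpace cnormD cnormZ cnorm_eq0.

Lemma normrE y : `|y| = (onorm y)%:C.
Proof. by []. Qed.

Lemma ball_evP (y z : orbitSpace) (e : R[i]) :
  ball y e z <-> (onorm (y - z))%:C < e.
Proof. by rewrite -ball_normE. Qed.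

(** Entrywise limits exist since evaluations are contractions; the limit is
    again a backward orbit by continuity of [C], and it is approached in norm
    because the Cauchy estimates are uniform in the index. *)
Lemma orbit_complete (F : set_system orbitSpace) :
  ProperFilter F -> cauchy F -> cvg F.
Proof.
move=> FF /cauchyP cF.
have ev_cvg n : cvg ((fun y : orbitSpace => y n) x @[x --> F]).
  apply: cauchy_cvg; apply: cauchy_exP => e e0.
  have [x Fx] := cF _ e0; exists (x n).
  suff : F [set y : orbitSpace | ball (x n) e (y n)] by [].
  apply: filterS Fx => y /ball_evP xy; rewrite -ball_normE/= normE.
  apply: le_lt_trans xy.
  by rewrite lecR -evB rnorm_ev_le.
pose l n : H := lim ((fun y : orbitSpace => y n) x @[x --> F]).
have Fl n : (fun y : orbitSpace => y n) x @[x --> F] --> l n by exact: ev_cvg.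
have l_le x (e : R[i]) : F (ball x e) -> forall n, rnorm (x n - l n) <= complex.Re e.
  move=> Fx n.
  have Fxn : rnorm (x n - (y : orbitSpace) n) @[y --> F] --> rnorm (x n - l n).
    by apply: cvg_rnorm; apply: cvgB; [exact: cvg_cst|exact: Fl].
  apply: (cvgr_to_le Fxn); apply: filterS Fx => y /ball_evP.
  rewrite ltcE => /andP[_ /= xy]; rewrite -evB.
  exact: le_trans (rnorm_ev_le _ _) (ltW xy).
have lP : l \in backward.
  apply/asboolP; split=> [n|].
    have Cl : C ((y : orbitSpace) n.+1) @[y --> F] --> C (l n.+1).
      exact: bounded_cvg cfun_bounded (Fl _).
    apply: (limH_unique Cl).
    rewrite (_ : (fun y : orbitSpace => C (y n.+1)) = (fun y : orbitSpace => y n)).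
      exact: Fl.
    by apply/funext => y; rewrite orbitS.
  have [x Fx] := cF _ (@ltr01 R[i]).
  exists (onorm x + 1) => n.
  rewrite -[l n](subrK (x n)) addrC (le_trans (ler_rnormD _ _))//.
  by rewrite lerD ?rnorm_ev_le// rnormBC; exact: l_le Fx n.
apply/cvg_ex; exists (Orbit lP); apply/cvg_ballP => e e0.
have [/eqP Ime r0] : complex.Im e == 0 /\ 0 < complex.Re e.
  by move: e0; rewrite ltcE => /andP[].
have [|x Fx] := cF (complex.Re e / 4)%:C; first by rewrite ltcR divr_gt0.
apply: filterS (Fx) => y /ball_evP; rewrite ltcR => xy; apply/ball_evP.
rewrite ltcE/= Ime eqxx/= (@le_lt_trans _ _ (complex.Re e / 2))//; last by lra.
apply: onorm_le => n; rewrite evB/= (le_trans (ler_rnormB _ (x n) _))//.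
have := l_le _ _ Fx n; rewrite rnormBC/=.
have := rnorm_ev_le (x - y) n; rewrite evB; lra.
Qed.

HB.instance Definition _ := Uniform_isComplete.Build orbitSpace orbit_complete.

(** Polarization, which reduces the existence of the limit of the inner products
    to that of the norms. *)
Definition opolar y z : R :=
  4^-1 * (onorm (y + z) ^+ 2 - onorm (y - z) ^+ 2).

Lemma cvg_opolar y z : rin (y n) (z n) @[n --> \oo] --> opolar y z.
Proof.
rewrite (_ : (fun n => rin (y n) (z n)) =
    fun n => 4^-1 * (rnorm ((y + z) n) ^+ 2 - rnorm ((y - z) n) ^+ 2)).
  apply: cvgM; first exact: cvg_cst.
  by apply: cvgB; apply: cvg_sqr; exact: cvg_onorm.
by apply/funext => n; rewrite rin_polar.
Qed.

Definition oinner y z : R[i] := opolar y z +i* opolar y ('i *: z).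

Lemma cvg_oinner y z : ccvg (fun n => inner (y n) (z n)) (oinner y z).
Proof.
split => /=; first exact: cvg_opolar.
rewrite (_ : (fun n => _) = fun n => rin (y n) (('i *: z) n)).
  exact: cvg_opolar.
by apply/funext => n; rewrite innerE.
Qed.

Lemma oinner_linl z : GRing.linear_for *%R (oinner^~ z).
Proof.
move=> a x y; apply: (ccvg_unique (@cvg_oinner _ _)).
rewrite (_ : (fun n => _) = fun n => a * inner (x n) (z n) + inner (y n) (z n)).
  by apply: ccvgP; exact: cvg_oinner.
by apply/funext => n; rewrite evD evZ linearDl/= innerZl.
Qed.

Lemma oinner_herm y z : oinner y z = (-1) ^+ false * Num.conj (oinner z y).
Proof.
rewrite expr0 mul1r; apply: (ccvg_unique (@cvg_oinner _ _)).
rewrite (_ : (fun n => _) = fun n => (inner (z n) (y n))^*).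
  by apply: ccvgJ; exact: cvg_oinner.
by apply/funext => n; rewrite innerC.
Qed.

Lemma oinner_linr z :
  GRing.linear_for ((@Num.conj R[i]) \; *%R) (oinner z).
Proof.
move=> a x y; apply: (ccvg_unique (@cvg_oinner _ _)).
rewrite (_ : (fun n => _) = fun n => a^* * inner (z n) (x n) + inner (z n) (y n)).
  by apply: ccvgP; exact: cvg_oinner.
by apply/funext => n; rewrite evD evZ linearDr/= innerZr.
Qed.

Lemma oinner_norm y : `|y| ^+ 2 = oinner y y.
Proof.
rewrite normrE; apply: (ccvg_unique _ (@cvg_oinner _ _)).
rewrite (_ : (fun n => _) = fun n => (rnorm (y n) ^+ 2)%:C).
  rewrite -rmorphXn; split => /=; last exact: cvg_cst.
  by apply: cvg_sqr; exact: cvg_onorm.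
by apply/funext => n; rewrite -inner_normE normE -rmorphXn.
Qed.

Lemma oinner_gt0 y : y != 0 -> 0 < oinner y y.
Proof. by move=> y0; rewrite -oinner_norm exprn_gt0// normr_gt0. Qed.

HB.instance Definition _ := bilinear_isBilinear.Build R[i] orbitSpace orbitSpace R[i]
  *%R ((@Num.conj R[i]) \; *%R) oinner (oinner_linl, oinner_linr).
HB.instance Definition _ := isHermitianSesquilinear.Build R[i] orbitSpace false
  (@Num.conj R[i]) oinner oinner_herm.
HB.instance Definition _ := isDotProduct.Build R[i] orbitSpace oinner oinner_gt0.

HB.instance Definition _ :=
  CompleteNormedModule_isHilbert.Build R orbitSpace oinner_norm.

Lemma cvg_rnorm_ev y : rnorm (y n) @[n --> \oo] --> rnorm y.
Proof. exact: cvg_onorm. Qed.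

Lemma cvg_rin_ev y z : rin (y n) (z n) @[n --> \oo] --> rin y z.
Proof. exact: cvg_opolar. Qed.

Lemma ev_le y n : rnorm (y n) <= rnorm y.
Proof. exact: rnorm_ev_le. Qed.

End BackwardOrbits.

(** * Sequences asymptotic to a backward orbit *)

Section Asymptotics.
Context {R : realType} {H : hilbertType R} {C : contrOperator H}.
Implicit Types (x : H) (y z w : orbitSpace C) (u v : nat -> H).

Lemma iter_lin (A : H -> H) n : linear A -> linear (iter n A).
Proof.
move=> linA; elim: n => [//|n IH] a x1 x2 /=.
by rewrite IH linA.
Qed.

Lemma iter_le (A : H -> H) n x : (forall x, rnorm (A x) <= rnorm x) ->
  rnorm (iter n A x) <= rnorm x.
Proof. by move=> A1; elim: n => [//|n IH] /=; exact: le_trans (A1 _) IH. Qed.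

Lemma ev_iter y n k : iter k C (y (n + k)%N) = y n.
Proof.
elim: k n => [|k IH] n; first by rewrite addn0.
by rewrite iterSr addnS orbitS IH.
Qed.

Lemma ev_sum (I : Type) (r : seq I) (F : I -> orbitSpace C) n :
  (\sum_(i <- r) F i) n = \sum_(i <- r) F i n.
Proof. exact: (big_morph (fun w : orbitSpace C => w n)). Qed.

(** [w] is the only backward orbit at vanishing distance from [u]; this is how
    elements and operators of the orbit space are recovered from [H]. *)
Definition asymptotic u w := rnorm (u n - w n) @[n --> \oo] --> (0 : R).

Lemma asymptotic_ev w : asymptotic w w.
Proof.
rewrite /asymptotic (_ : (fun n => _) = fun=> 0); first exact: cvg_cst.
by apply/funext => n; rewrite subrr rnorm0.
Qed.

(** The norm of the orbit space is visible on any asymptotic sequence. This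
    transfers norm bounds from [H] to the orbit space. *)
Lemma cvg_rnorm_asymptotic u w : asymptotic u w ->
  rnorm (u n) @[n --> \oo] --> rnorm w.
Proof.
move=> uw; rewrite -[rnorm w]add0r.
rewrite (_ : (fun n => _) = fun n => (rnorm (u n) - rnorm (w n)) + rnorm (w n)).
  apply: cvgD; last exact: cvg_rnorm_ev.
  by apply/norm_cvg0P; apply: squeeze0 uw => n; rewrite normr_ge0 abs_rnormB.
by apply/funext => n; rewrite subrK.
Qed.

Lemma asymptotic_le u w (c : R) : asymptotic u w ->
  (forall n, rnorm (u n) <= c) -> rnorm w <= c.
Proof.
by move=> /cvg_rnorm_asymptotic uw uc; apply: (cvgr_to_le uw); exact: nearW.
Qed.

Lemma asymptotic_trans u v w :
  rnorm (u n - v n) @[n --> \oo] --> (0 : R) -> asymptotic v w -> asymptotic u w.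
Proof.
move=> uv vw.
apply: (@squeeze0 _ _ _ _ _ (fun n => rnorm (u n - v n) + rnorm (v n - w n))).
  by move=> n; rewrite rnorm_ge0 ler_rnormB.
by rewrite -(addr0 0); apply: cvgD.
Qed.

Lemma asymptotic_lincomb (a : R[i]) u v w z :
  asymptotic u w -> asymptotic v z ->
  asymptotic (fun n => a *: u n + v n) (a *: w + z).
Proof.
move=> uw vz; apply: (@squeeze0 _ _ _ _ _ (fun n =>
    complex.Re `|a| * rnorm (u n - w n) + rnorm (v n - z n))) => [n|].
  rewrite rnorm_ge0 -rnormZ; apply: le_trans (ler_rnormD _ _).
  by rewrite evD evZ scalerBr addrACA opprD.
rewrite -[0](addr0 0) -[X in _ --> X + _](mulr0 (complex.Re `|a|)).
by apply: cvgD => //; apply: cvgM => //; exact: cvg_cst.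
Qed.

Lemma asymptotic_unique u w z : asymptotic u w -> asymptotic u z -> w = z.
Proof.
move=> uw uz; apply/eqP; rewrite -subr_eq0 -[w](scale1r w) -scaleN1r.
rewrite scale1r addrC; apply/eqP/rnorm0_eq0/le_anti; rewrite rnorm_ge0 andbT.
apply: (asymptotic_le (asymptotic_lincomb (-1) uz uw)) => n.
by rewrite scaleN1r addNr rnorm0.
Qed.

Lemma asymptotic_sum m (u : 'I_m -> nat -> H) (w : 'I_m -> orbitSpace C) :
  (forall j, asymptotic (u j) (w j)) ->
  asymptotic (fun n => \sum_(j < m) u j n) (\sum_(j < m) w j).
Proof.
elim: m u w => [|m IH] u w uw.
  rewrite /asymptotic (_ : (fun n => _) = fun=> 0); first exact: cvg_cst.
  by apply/funext => n; rewrite !big_ord0 ev0 subrr rnorm0.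
have := asymptotic_lincomb 1 (uw ord0) (IH _ _ (fun j => uw (lift ord0 j))).
rewrite scale1r big_ord_recl; congr (asymptotic _ _).
by apply/funext => n; rewrite scale1r big_ord_recl.
Qed.

(** * The shift and entrywise operators *)

Lemma shift_backward y : (fun n => y n.+1) \in backward C.
Proof.
apply/asboolP; split=> [n|]; first by rewrite orbitS.
by exists (rnorm y) => n; exact: ev_le.
Qed.

Definition oshift y : orbitSpace C := Orbit (shift_backward y).

Lemma iter_oshiftE k y n : iter k oshift y n = y (n + k)%N.
Proof. by elim: k n => [|k IH] n; rewrite ?addn0//= IH addnS. Qed.

Lemma rnorm_oshift y : rnorm (oshift y) = rnorm y.
Proof.
apply: (@limR_unique _ _ \oo _ (fun n => rnorm (y n.+1))).
  exact: (@cvg_rnorm_ev _ _ _ (oshift y)).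
by have := @cvg_rnorm_ev _ _ _ y; rewrite -cvg_shiftS.
Qed.

Lemma rnorm_iter_shift k y : rnorm (iter k oshift y) = rnorm y.
Proof. by elim: k => [//|k IH] /=; rewrite rnorm_oshift IH. Qed.

Lemma cvg_ev_gap y m :
  rnorm y ^+ 2 - rnorm (y (n + m)%N) ^+ 2 @[n --> \oo] --> (0 : R).
Proof.
rewrite -(subrr (rnorm y ^+ 2)); apply: cvgB; first exact: cvg_cst.
apply: cvg_sqr; rewrite -(rnorm_iter_shift m).
rewrite (_ : (fun n => _) = fun n => rnorm (iter m oshift y n)).
  exact: cvg_rnorm_ev.
by apply/funext => n; rewrite iter_oshiftE.
Qed.

Lemma unshift_backward y : (fun n => C (y n)) \in backward C.
Proof.
apply/asboolP; split=> [n|]; first by rewrite orbitS.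
by exists (rnorm y) => n; exact: le_trans (cfun_le _ _) (ev_le _ _).
Qed.

Definition unshift y : orbitSpace C := Orbit (unshift_backward y).

Lemma oshiftK y : unshift (oshift y) = y.
Proof. by apply: orbitP => n /=; rewrite orbitS. Qed.

Lemma unshiftK y : oshift (unshift y) = y.
Proof. by apply: orbitP => n /=; rewrite orbitS. Qed.

Lemma rnorm_unshift y : rnorm (unshift y) = rnorm y.
Proof. by rewrite -rnorm_oshift unshiftK. Qed.

Section Entrywise.
Variable A : H -> H.
Hypotheses (bA : bounded_operator A) (AC : forall x, A (C x) = C (A x)).

Lemma entrywise_backward y : (fun n => A (y n)) \in backward C.
Proof.
apply/asboolP; split=> [n|]; first by rewrite -AC orbitS.
exists (opnorm A * rnorm y) => n; rewrite (le_trans (opnorm_ub bA _))//.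
by rewrite ler_wpM2l ?opnorm_ge0// ev_le.
Qed.

Definition entrywise y : orbitSpace C := Orbit (entrywise_backward y).

Lemma entrywise_lin : linear entrywise.
Proof. by move=> a y z; apply: orbitP => n; rewrite /= (bounded_lin bA). Qed.

Lemma entrywise_le : (forall x, rnorm (A x) <= rnorm x) ->
  forall y, rnorm (entrywise y) <= rnorm y.
Proof.
move=> A1 y; apply: (asymptotic_le (asymptotic_ev _)) => n.
exact: le_trans (A1 _) (ev_le _ _).
Qed.

End Entrywise.

End Asymptotics.

(** * The canonical map into the orbit space *)

(** [C] is a bundled form of the adjoint of [P]. *)
Section Canonical.
Context {R : realType} {H : hilbertType R} {C : contrOperator H} {P : H -> H}.
Hypotheses (hP : contractive P) (PC : adj P = C).
Implicit Types (x : H) (y z w : orbitSpace C).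

Lemma canP_lin : linear P. Proof. by have /contractiveP[] := hP. Qed.
Lemma canP_le x : rnorm (P x) <= rnorm x.
Proof. by have /contractiveP[] := hP. Qed.

Lemma rin_iter n x1 x2 : rin (iter n P x1) x2 = rin x1 (iter n C x2).
Proof.
elim: n x1 x2 => [//|n IH] x1 x2; rewrite iterSr /=.
by rewrite IH (rin_adj hP.1) PC.
Qed.

(** Expand the square and use that [C] is contractive. *)
Lemma gap_iter k x :
  rnorm (iter k C (iter k P x) - x) ^+ 2 <=
  rnorm x ^+ 2 - rnorm (iter k P x) ^+ 2.
Proof.
rewrite rnormB_sqr rinC -rin_iter -rnorm_sqr.
have : rnorm (iter k C (iter k P x)) ^+ 2 <= rnorm (iter k P x) ^+ 2.
  rewrite ler_pXn2r// ?nnegrE ?rnorm_ge0// iter_le// => z; exact: cfun_le.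
lra.
Qed.

(** Expand the square: [C^k] maps [y (m + k)] to [y m], so the cross term is
    [rnorm (y m) ^+ 2]. Since the norms converge, a backward orbit of the adjoint
    is asymptotically a forward orbit of [P]. *)
Lemma gap_orbit y m k :
  rnorm (y (m + k)%N - iter k P (y m)) ^+ 2 <=
  rnorm (y (m + k)%N) ^+ 2 - rnorm (y m) ^+ 2.
Proof.
rewrite rnormB_sqr rinC rin_iter ev_iter -rnorm_sqr.
have : rnorm (iter k P (y m)) ^+ 2 <= rnorm (y m) ^+ 2.
  by rewrite ler_pXn2r// ?nnegrE ?rnorm_ge0// iter_le//; exact: canP_le.
lra.
Qed.

Definition limnorm x : R := inf (range (fun n => rnorm (iter n P x) ^+ 2)).

Lemma limnorm_lb x : has_lbound (range (fun n => rnorm (iter n P x) ^+ 2)).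
Proof. by exists 0 => _ [n _ <-]; exact: sqr_ge0. Qed.

Lemma limnorm_le x n : limnorm x <= rnorm (iter n P x) ^+ 2.
Proof. by apply: ge_inf; [exact: limnorm_lb|exists n]. Qed.

Lemma cvg_limnorm x : rnorm (iter n P x) ^+ 2 @[n --> \oo] --> limnorm x.
Proof.
apply: nonincreasing_cvgn; last exact: limnorm_lb.
apply/nonincreasing_seqP => n /=.
by rewrite ler_pXn2r// ?nnegrE ?rnorm_ge0// canP_le.
Qed.

(** The strong limit of the decreasing sequence of positive contractions
    [C^n P^n]. *)
Definition asymptote x : H := lim (iter n C (iter n P x) @[n --> \oo]).

(** [gap_iter] at [P^m x] bounds the increments by those of a convergent
    monotone sequence; no square root of an operator is needed. *)
Lemma cvg_asymptote x : iter n C (iter n P x) @[n --> \oo] --> asymptote x.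
Proof.
apply: (@cauchy_modulus _ _ _ (fun m => rnorm (iter m P x) ^+ 2 - limnorm x)).
  move=> m k; rewrite !iterD -(linB (iter_lin m (cfun_lin C))).
  rewrite -iterD addnC iterD.
  apply: (@le_trans _ _ (rnorm (iter k C (iter k P (iter m P x)) - iter m P x) ^+ 2)).
    rewrite ler_pXn2r// ?nnegrE ?rnorm_ge0// iter_le// => z; exact: cfun_le.
  rewrite (le_trans (gap_iter _ _))// lerD2l lerN2 -iterD.
  exact: limnorm_le.
rewrite -(subrr (limnorm x)); apply: cvgB; last exact: cvg_cst.
exact: cvg_limnorm.
Qed.

Lemma asymptote_le x : rnorm (asymptote x) <= rnorm x.
Proof.
apply: (cvgr_to_le (cvg_rnorm (@cvg_asymptote x))); apply: nearW => n.
rewrite (le_trans (iter_le _ _ _))//; first exact: cfun_le.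
by rewrite iter_le//; exact: canP_le.
Qed.

Lemma asymptote_lin : linear asymptote.
Proof.
move=> a x1 x2; apply: (limH_unique (@cvg_asymptote _)).
rewrite (_ : (fun n => _) =
    fun n => a *: iter n C (iter n P x1) + iter n C (iter n P x2)).
  by apply: cvgD; [apply: cvgZl_tmp; exact: cvg_asymptote|exact: cvg_asymptote].
by apply/funext => n; rewrite (iter_lin n canP_lin) (iter_lin n (cfun_lin C)).
Qed.

(** Reindex the limit: [C (C^n P^n) P] is [C^(n+1) P^(n+1)]. *)
Lemma asymptote_step x : C (asymptote (P x)) = asymptote x.
Proof.
apply: (@limH_unique _ _ _ \oo _ (fun n => iter n.+1 C (iter n.+1 P x))).
  rewrite (_ : (fun n => _) = fun n => C (iter n C (iter n P (P x)))).
    by apply: bounded_cvg; [exact: cfun_bounded|exact: cvg_asymptote].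
  by apply/funext => n; rewrite /= -iterSr.
by have := @cvg_asymptote x; rewrite -cvg_shiftS.
Qed.

(** The limit of [gap_iter]: the bound is the part of the squared norm still to
    be lost along the orbit of [x], which tends to 0 along [P^n x]. *)
Lemma gap_asymptote x :
  rnorm (asymptote x - x) ^+ 2 <= rnorm x ^+ 2 - limnorm x.
Proof.
have h : rnorm (iter n C (iter n P x) - x) ^+ 2 @[n --> \oo] -->
    rnorm (asymptote x - x) ^+ 2.
  apply: cvg_sqr; apply: cvg_rnorm; apply: cvgB; last exact: cvg_cst.
  exact: cvg_asymptote.
apply: (cvgr_to_le h); apply: nearW => n; rewrite (le_trans (gap_iter _ _))//.
by rewrite lerD2l lerN2 limnorm_le.
Qed.

Lemma limnorm_iter x n : limnorm (iter n P x) = limnorm x.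
Proof.
apply: (limR_unique (@cvg_limnorm _)).
rewrite (_ : (fun k => _) = fun k => rnorm (iter (k + n) P x) ^+ 2).
  by have := @cvg_limnorm x; rewrite -(cvg_shiftn n).
by apply/funext => k; rewrite iterD.
Qed.

Lemma asymptote_backward x : (fun n => asymptote (iter n P x)) \in backward C.
Proof.
apply/asboolP; split=> [n|]; first by rewrite asymptote_step.
exists (rnorm x) => n; rewrite (le_trans (asymptote_le _))// iter_le//.
exact: canP_le.
Qed.

Definition canonicalMap x : orbitSpace C := Orbit (asymptote_backward x).

Lemma canonicalMapE x n : canonicalMap x n = asymptote (iter n P x).
Proof. by []. Qed.

Lemma canonicalMap_lin : linear canonicalMap.
Proof.
move=> a x1 x2; apply: orbitP => n; rewrite evD evZ !canonicalMapE.
by rewrite (iter_lin n canP_lin) asymptote_lin.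
Qed.

Lemma canonicalMap_le x : rnorm (canonicalMap x) <= rnorm x.
Proof.
apply: (asymptotic_le (asymptotic_ev _)) => n; rewrite canonicalMapE.
rewrite (le_trans (asymptote_le _))// iter_le//.
exact: canP_le.
Qed.

Lemma canonicalMap_contractive : contractive canonicalMap.
Proof.
by apply/contractiveP; split; [exact: canonicalMap_lin|exact: canonicalMap_le].
Qed.

Lemma asymptotic_canonicalMap x :
  asymptotic (fun n => iter n P x) (canonicalMap x).
Proof.
apply: cvg_sqr0 => [n|]; first exact: rnorm_ge0.
apply: (@squeeze0 _ _ _ _ _ (fun n => rnorm (iter n P x) ^+ 2 - limnorm x)).
  move=> n; rewrite sqr_ge0 rnormBC canonicalMapE (le_trans (gap_asymptote _))//.
  by rewrite limnorm_iter.
rewrite -(subrr (limnorm x)); apply: cvgB; last exact: cvg_cst.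
exact: cvg_limnorm.
Qed.

(** [canonicalMap x] is asymptotic to [P^n x], and the inner product of [P^n x]
    with [z n] does not depend on [n]. *)
Lemma rin_canonicalMap x z : rin (canonicalMap x) z = rin x (z 0%N).
Proof.
apply: (limR_unique (@cvg_rin_ev _ _ _ _ _)).
rewrite (_ : (fun n => _) = fun n =>
  rin x (z 0%N) - rin (iter n P x - canonicalMap x n) (z n)).
  rewrite -[X in _ --> X]subr0; apply: cvgB; first exact: cvg_cst.
  apply/norm_cvg0P; apply: (@squeeze0 _ _ _ _ _
      (fun n => rnorm (iter n P x - canonicalMap x n) * rnorm z)) => [n|].
    rewrite normr_ge0 (le_trans (abs_rin_le _ _))// ler_wpM2l ?rnorm_ge0//.
    exact: ev_le.
  rewrite -(mul0r (rnorm z)); apply: cvgM; last exact: cvg_cst.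
  exact: asymptotic_canonicalMap.
apply/funext => n; rewrite rinBl rin_iter.
by have := ev_iter z 0 n; rewrite add0n => ->; lra.
Qed.

Lemma adj_canonicalMap : adj canonicalMap = fun z : orbitSpace C => z 0%N.
Proof. by apply: adjP; [exact: canonicalMap_lin|exact: rin_canonicalMap]. Qed.

(** Expand the square: evaluation at 0 is the adjoint of [canonicalMap], and the
    entry at 0 of the shifted sequence is [y n], so the cross term is
    [rnorm (y n) ^+ 2]. *)
Lemma gap_shift y n :
  rnorm (canonicalMap (y n) - iter n oshift y) ^+ 2 <=
  rnorm y ^+ 2 - rnorm (y n) ^+ 2.
Proof.
rewrite rnormB_sqr rin_canonicalMap iter_oshiftE add0n -rnorm_sqr rnorm_iter_shift.
have : rnorm (canonicalMap (y n)) ^+ 2 <= rnorm (y n) ^+ 2.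
  by rewrite ler_pXn2r// ?nnegrE ?rnorm_ge0// canonicalMap_le.
lra.
Qed.

Lemma cvg_gap_shift y :
  rnorm (canonicalMap (y n) - iter n oshift y) @[n --> \oo] --> (0 : R).
Proof.
apply: cvg_sqr0 => [n|]; first exact: rnorm_ge0.
apply: (@squeeze0 _ _ _ _ _ (fun n => rnorm y ^+ 2 - rnorm (y n) ^+ 2)).
  by move=> n; rewrite sqr_ge0 gap_shift.
have := @cvg_ev_gap _ _ _ y 0%N.
by under eq_fun do rewrite addn0.
Qed.

End Canonical.

(** * Products of commuting contractions *)

Section Products.
Context {R : realType} {H : hilbertType R}.

Lemma contractive_comp (A B : H -> H) :
  contractive A -> contractive B -> contractive (A \o B).
Proof.
move=> /contractiveP[lA A1] /contractiveP[lB B1]; apply/contractiveP; split.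
  by move=> a x y /=; rewrite lB lA.
by move=> x /=; exact: le_trans (A1 _) (B1 _).
Qed.

Lemma contractive_id : contractive (@idfun H).
Proof. exact/contractiveP. Qed.

Lemma adj_contractive (A : H -> H) : contractive A -> contractive (adj A).
Proof.
move=> cA; have /contractiveP[lA A1] := cA.
apply/contractiveP; split; first exact: adj_lin cA.1.
move=> x; rewrite -[X in _ <= X]mul1r; apply: (adj_ub cA.1) => // z.
by rewrite mul1r.
Qed.

Context {d : nat} {T : 'I_d -> H -> H}.
Hypotheses (hT : forall i, contractive (T i)) (comT : commuting T).

(** Partial products, over which inductions on the number of factors are done. *)
Definition partprod (r : seq 'I_d) : H -> H :=
  \big[(fun A B : H -> H => A \o B)/idfun]_(i <- r) T i.

Lemma partprod_cons i r : partprod (i :: r) = T i \o partprod r.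
Proof. by rewrite /partprod big_cons. Qed.

Lemma partprod_nil : partprod [::] = idfun.
Proof. by rewrite /partprod big_nil. Qed.

Lemma partprod_contractive r : contractive (partprod r).
Proof.
elim: r => [|i r IH]; first by rewrite partprod_nil; exact: contractive_id.
by rewrite partprod_cons; exact: contractive_comp.
Qed.

Lemma partprod_comm r i x : partprod r (T i x) = T i (partprod r x).
Proof.
elim: r => [|j r IH]; first by rewrite partprod_nil.
by rewrite !partprod_cons /= IH; exact: (congr1 (@^~ (partprod r x)) (comT j i)).
Qed.

Lemma opprod_contractive : contractive (opprod T).
Proof. exact: partprod_contractive. Qed.

Lemma opprod_comm i x : opprod T (T i x) = T i (opprod T x).
Proof. exact: partprod_comm. Qed.

(** [S] is the product of the remaining factors. *)
Lemma partprod_cofactor r i : i \in r -> exists S : H -> H,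
  [/\ contractive S, forall j x, S (T j x) = T j (S x)
    & forall x, partprod r x = T i (S x)].
Proof.
elim: r => [//|j r IH]; rewrite in_cons.
have [<- _|_ /= /IH[S [cS SC Sr]]] := eqVneq.
  exists (partprod r); split=> [|k x|x]; first exact: partprod_contractive.
    exact: partprod_comm.
  by rewrite partprod_cons.
exists (T j \o S); split=> [|k x|x]; first exact: contractive_comp.
  by rewrite /= SC; exact: (congr1 (@^~ (S x)) (comT j k)).
rewrite partprod_cons /= Sr.
exact: (congr1 (@^~ (S x)) (comT j i)).
Qed.

Lemma opprod_cofactor i : exists S : H -> H,
  [/\ contractive S, forall j x, S (T j x) = T j (S x)
    & forall x, opprod T x = T i (S x)].
Proof. by apply: partprod_cofactor; rewrite mem_index_enum. Qed.

End Products.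

(** * The unitary extension *)

Section Extension.
Context {R : realType} {H : hilbertType R} {d : nat} {T : 'I_d -> H -> H}.
Hypotheses (hT : forall i, contractive (T i)) (comT : commuting T).

Definition adjoint_product : contrOperator H :=
  ContrOperator (adj_contractive (opprod_contractive hT)).

Local Notation P := (opprod T).
Local Notation C := adjoint_product.
Local Notation K := (orbitSpace C).

Let hP : contractive P. Proof. exact: opprod_contractive. Qed.
Let PC : adj P = C. Proof. by []. Qed.

(** The map [J] of the pseudo-extension. *)
Definition cano : H -> K := canonicalMap hP PC.

Lemma adj_comm (A B : H -> H) : bounded_operator A -> bounded_operator B ->
  (forall x, A (B x) = B (A x)) -> forall x, adj A (adj B x) = adj B (adj A x).
Proof.
move=> bA bB AB x.
have /(congr1 (@adj _ _ _)) : A \o B = B \o A by apply/funext.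
by rewrite (adj_comp bA bB) (adj_comp bB bA) => /(congr1 (@^~ x)).
Qed.

Let adjTC i x : adj (T i) (C x) = C (adj (T i) x).
Proof.
by apply: adj_comm; [exact: (hT i).1|exact: hP.1|move=> z; rewrite opprod_comm].
Qed.

(** The adjoint of the unitary [ext i] below; on this side the action on
    sequences is entrywise. *)
Definition coext i : K -> K := entrywise (adj_bounded (hT i).1) (adjTC i).

Lemma coextE i (y : K) n : coext i y n = adj (T i) (y n). Proof. by []. Qed.

Lemma coext_lin i : linear (coext i). Proof. exact: entrywise_lin. Qed.

Lemma coext_le i y : rnorm (coext i y) <= rnorm y.
Proof.
by apply: entrywise_le; have /contractiveP[] := adj_contractive (hT i).
Qed.

Lemma coext_contractive i : contractive (coext i).
Proof. by apply/contractiveP; split; [exact: coext_lin|exact: coext_le]. Qed.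

(** The witness is the entrywise adjoint of the product of the other factors. *)
Lemma coext_factor i : exists W : K -> K,
  (forall y, rnorm (W y) <= rnorm y) /\
  (forall y, W (coext i y) = unshift y /\ coext i (W y) = unshift y).
Proof.
have [S [cS SC PS]] := opprod_cofactor hT comT i.
have SP x : S (P x) = P (S x) by rewrite !PS !SC.
have adjSC x : adj S (C x) = C (adj S x).
  by apply: adj_comm; [exact: cS.1|exact: hP.1|].
exists (entrywise (adj_bounded cS.1) adjSC); split.
  by apply: entrywise_le; have /contractiveP[] := adj_contractive cS.
have PT : P = T i \o S by apply/funext.
have CE x : adj S (adj (T i) x) = C x.
  by rewrite /= PT (adj_comp (hT i).1 cS.1).
move=> y; split; apply: orbitP => n; first exact: CE.
rewrite -[RHS]CE; apply: adj_comm; [exact: (hT i).1|exact: cS.1|].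
by move=> x; rewrite SC.
Qed.

(** A contraction that is a factor of an isometry is isometric. *)
Lemma coext_iso i y : rnorm (coext i y) = rnorm y.
Proof.
apply/le_anti; rewrite coext_le/=.
have [W [W1 /(_ y)[Wy _]]] := coext_factor i.
by rewrite -(rnorm_unshift y) -Wy W1.
Qed.

Lemma coext_surj i y : exists z, coext i z = y.
Proof.
have [W [_ /(_ (oshift y))[_ Wy]]] := coext_factor i.
by exists (W (oshift y)); rewrite Wy oshiftK.
Qed.

Definition ext i : K -> K := adj (coext i).

Lemma adj_ext i : adj (ext i) = coext i.
Proof. exact: adjK (coext_contractive i).1. Qed.

Lemma ext_bounded i : bounded_operator (ext i).
Proof. exact: adj_bounded (coext_contractive i).1. Qed.

Lemma coextK i y : ext i (coext i y) = y.
Proof.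
apply: rin_eq => z; rewrite -(rin_adj (coext_contractive i).1).
by rewrite !rin_polar -(linD (coext_lin i)) -(linB (coext_lin i)) !coext_iso.
Qed.

Lemma extK i y : coext i (ext i y) = y.
Proof. by have [z <-] := coext_surj i y; rewrite coextK. Qed.

Lemma ext_unitary i : unitary_operator (ext i).
Proof.
split; first exact: ext_bounded.
  by rewrite adj_ext; apply/funext => y /=; rewrite extK.
by rewrite adj_ext; apply/funext => y /=; rewrite coextK.
Qed.

Lemma rnorm_ext i y : rnorm (ext i y) = rnorm y.
Proof. by rewrite -(coext_iso i) extK. Qed.

Lemma coext_comm i j y : coext i (coext j y) = coext j (coext i y).
Proof.
apply: orbitP => n; apply: adj_comm; [exact: (hT i).1|exact: (hT j).1|].
by move=> x; exact: (congr1 (@^~ x) (comT i j)).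
Qed.

Lemma ext_commuting : commuting ext.
Proof.
move=> i j; have bV k := (coext_contractive k).1.
have /(congr1 (@adj _ _ _)) E : coext i \o coext j = coext j \o coext i.
  by apply/funext => y; exact: coext_comm.
apply: etrans (adj_comp (bV i) (bV j)).
by rewrite E (adj_comp (bV j) (bV i)).
Qed.

Lemma cano_bounded : bounded_operator cano.
Proof. exact: (canonicalMap_contractive hP PC).1. Qed.

Lemma adj_cano : adj cano = fun y : K => y 0%N.
Proof. exact: adj_canonicalMap. Qed.

(** Both sides have the same inner products with [z], as the adjoint of [J] is
    evaluation at 0 and that of [ext i] is entrywise. *)
Lemma cano_ext i x : cano (T i x) = ext i (cano x).
Proof.
apply: rin_eq => z; rewrite rinC -(rin_adj (coext_contractive i).1).
rewrite ![rin _ (cano _)]rinC !rin_canonicalMap.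
by rewrite (rin_adj (hT i).1).
Qed.

(** [T i] does not act entrywise on backward orbits, but it does so up to a null
    sequence. Expanding the square, the cross term is the inner product of
    [coext i (ext i y) n = y n] with itself, and [ext i] preserves the norm. *)
Lemma asymptotic_ext i (y : K) : asymptotic (fun n => T i (y n)) (ext i y).
Proof.
apply: cvg_sqr0 => [n|]; first exact: rnorm_ge0.
apply: (@squeeze0 _ _ _ _ _ (fun n => rnorm y ^+ 2 - rnorm (y n) ^+ 2)) => [n|].
  rewrite sqr_ge0 rnormB_sqr (rin_adj (hT i).1) -coextE extK -rnorm_sqr.
  have /contractiveP[_ /(_ (y n))] := hT i.
  rewrite -(ler_pXn2r (_ : 0 < 2)%N) ?nnegrE ?rnorm_ge0// => h1.
  have := ev_le (ext i y) n; rewrite rnorm_ext.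
  rewrite -(ler_pXn2r (_ : 0 < 2)%N) ?nnegrE ?rnorm_ge0// => h2.
  lra.
have := @cvg_ev_gap _ _ _ y 0%N.
by under eq_fun do rewrite addn0.
Qed.

(** * The commutant of the unitaries *)

Lemma commutant_ext Y i y : commutant (range ext) Y -> Y (ext i y) = ext i (Y y).
Proof.
move=> [_ YU]; have := YU (ext i); move/(_ (ex_intro2 _ _ i I erefl)).
by move/(congr1 (@^~ y)).
Qed.

Lemma commutant_coext Y i y : commutant (range ext) Y ->
  Y (coext i y) = coext i (Y y).
Proof.
by move=> cY; rewrite -[in RHS](coextK i y) (commutant_ext _ _ cY) extK.
Qed.

Lemma commutantP Y : bounded_operator Y ->
  (forall i y, coext i (Y (ext i y)) = Y y) -> commutant (range ext) Y.
Proof.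
move=> bY YE; split=> // _ [i _ <-]; apply/funext => y /=.
by rewrite -[in RHS](YE i y) coextK.
Qed.

Lemma commutant_adj Y : commutant (range ext) Y -> commutant (range ext) (adj Y).
Proof.
move=> cY; apply: commutantP => [|i y]; first exact: adj_bounded cY.1.
have : adj Y \o coext i = coext i \o adj Y.
  have /(congr1 (@adj _ _ _)) : ext i \o Y = Y \o ext i.
    by apply/funext => z /=; rewrite (commutant_ext _ _ cY).
  rewrite (adj_comp (ext_bounded i) cY.1) (adj_comp cY.1 (ext_bounded i)).
  by rewrite adj_ext.
by move/(congr1 (@^~ (ext i y))) => /= <-; rewrite extK.
Qed.

(** A product of [coext i]; over all indices it is the inverse of the shift. *)
Definition coprod (r : seq 'I_d) (y : K) : K := foldl (fun z i => coext i z) y r.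

Lemma coprodE r y n : coprod r y n = adj (partprod (T := T) r) (y n).
Proof.
elim: r y => [|i r IH] y; first by rewrite partprod_nil adj_id.
rewrite /= IH partprod_cons adj_comp//; first exact: (hT i).1.
exact: (partprod_contractive hT r).1.
Qed.

Lemma unshiftE y : unshift y = coprod (index_enum 'I_d) y.
Proof. by apply: orbitP => n; rewrite coprodE. Qed.

(** The shift is the inverse of the product of the [coext i], each of which
    commutes with [Y]. *)
Lemma commutant_oshift Y k y : commutant (range ext) Y ->
  Y (iter k oshift y) = iter k oshift (Y y).
Proof.
move=> cY; elim: k => [//|k IH] /=; rewrite -IH; move: (iter k _ _) => z.
rewrite -[in RHS](oshiftK z).
have -> : Y (unshift (oshift z)) = unshift (Y (oshift z)).
  rewrite !unshiftE; elim: (index_enum _) (oshift z) => [//|i r IHr] w /=.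
  by rewrite IHr (commutant_coext _ _ cY).
by rewrite unshiftK.
Qed.

End Extension.

(** * Minimality and compressions *)

Section UnshiftIter.
Context {R : realType} {H : hilbertType R} {C : contrOperator H}.
Implicit Types y : orbitSpace C.

Lemma unshift_lin : linear (@unshift R H C).
Proof. by move=> a y z; apply: orbitP => n; rewrite /= (cfun_lin C). Qed.

Lemma iter_oshiftK n : cancel (iter n (@oshift R H C)) (iter n (@unshift R H C)).
Proof. by elim: n => [//|n IH] y; rewrite iterSr /= oshiftK IH. Qed.

Lemma rnorm_iter_unshift n y : rnorm (iter n (@unshift R H C) y) = rnorm y.
Proof. by elim: n => [//|n IH] /=; rewrite rnorm_unshift. Qed.

End UnshiftIter.

Section Compression.
Context {R : realType} {H : hilbertType R} {d : nat} {T : 'I_d -> H -> H}.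
Hypotheses (hT : forall i, contractive (T i)) (comT : commuting T).

Local Notation P := (opprod T).
Local Notation C := (adjoint_product hT).
Local Notation K := (orbitSpace C).
Local Notation J := (@cano R H d T hT).
Local Notation V := (@coext R H d T hT comT).
Local Notation U := (@ext R H d T hT comT).

Let hP : contractive P. Proof. exact: opprod_contractive. Qed.
Let PC : adj P = C. Proof. by []. Qed.

(** Every [y] is the limit of the vectors [iter n unshift (J (y n))], by
    [gap_shift]. *)
Lemma cano_minimal (M : set K) : linear_subspace M -> closed M ->
  (forall j, reducing M (U j)) -> range J `<=` M -> M = setT.
Proof.
move=> _ Mcl MU MJ; apply/seteqP; split=> // y _.
have MV i z : M z -> M (V i z) by rewrite -adj_ext; exact: (MU i).2.
have Munshift z : M z -> M (unshift z).
  rewrite unshiftE; elim: (index_enum _) z => [//|i r IH] z Mz /=.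
  exact/IH/MV.
pose z n : K := iter n unshift (J (y n)).
apply: (@closed_cvg _ _ \oo _ z M Mcl _ y).
  apply: nearW => n; rewrite /z.
  by elim: n (J _) (MJ (J (y n)) (ex_intro2 _ _ (y n) I erefl)) => [//|n IH] w Mw /=;
    exact/Munshift/IH.
apply/cvg_rnormBP.
rewrite (_ : (fun n => _) = fun n => rnorm (J (y n) - iter n oshift y)).
  exact: cvg_gap_shift.
apply/funext => n; rewrite /z -[X in _ - X](iter_oshiftK n y).
by rewrite -(linB (iter_lin n (@unshift_lin _ _ _))) rnorm_iter_unshift.
Qed.

Lemma compressionE (Y : K -> K) x : pseudo_compression J Y x = Y (J x) 0%N.
Proof. by rewrite /pseudo_compression /= adj_cano. Qed.

Lemma compression_bounded Y : bounded_operator Y ->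
  bounded_operator (pseudo_compression J Y).
Proof.
move=> bY; apply: bounded_comp; last exact: cano_bounded.
by apply: bounded_comp => //; exact: adj_bounded (cano_bounded hT).
Qed.

Lemma adj_compression Y : bounded_operator Y ->
  adj (pseudo_compression J Y) = pseudo_compression J (adj Y).
Proof.
move=> bY; have bJ := cano_bounded hT; have bJ' := adj_bounded bJ.
rewrite /pseudo_compression (adj_comp (bounded_comp bJ' bY) bJ).
by rewrite (adj_comp bJ' bY) (adjK bJ).
Qed.

(** The entry at [n] of [Y y] is the entry at 0 of [Y] applied to the [n]-fold
    shift of [y], and that shift is close to [J (y n)]. *)
Lemma asymptotic_compression Y (y : K) : commutant (range U) Y ->
  asymptotic (fun n => pseudo_compression J Y (y n)) (Y y).
Proof.
move=> cY; have bY := cY.1.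
apply: (@squeeze0 _ _ _ _ _
    (fun n => opnorm Y * rnorm (J (y n) - iter n oshift y))) => [n|].
  rewrite rnorm_ge0 compressionE.
  have -> : Y y n = Y (iter n oshift y) 0%N.
    by rewrite (commutant_oshift _ _ cY) iter_oshiftE.
  rewrite -evB -(linB (bounded_lin bY)) (le_trans (ev_le _ _))//.
  exact: opnorm_ub.
rewrite -(mulr0 (opnorm Y)); apply: cvgM; first exact: cvg_cst.
exact: cvg_gap_shift.
Qed.

(** Moving [T i] through [J] on both sides turns it into the unitary [ext i],
    which commutes with [Y]. *)
Lemma compression_toeplitz Y : commutant (range U) Y ->
  toeplitz T (pseudo_compression J Y).
Proof.
move=> cY; split=> [|i]; first exact: compression_bounded cY.1.
apply/funext => x; rewrite /= !compressionE (cano_ext hT comT).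
rewrite (commutant_ext _ _ cY) -[LHS]/(V i _ 0%N).
by rewrite extK.
Qed.

(** * Toeplitz operators are compressions *)

Section Lift.
Variable A : H -> H.
Hypothesis tA : toeplitz T A.

Let bA : bounded_operator A. Proof. by case: tA. Qed.

Lemma toeplitz_partprod r x :
  adj (partprod (T := T) r) (A (partprod (T := T) r x)) = A x.
Proof.
elim: r x => [|i r IH] x; first by rewrite partprod_nil adj_id.
rewrite partprod_cons (adj_comp (hT i).1 (partprod_contractive hT r).1) /=.
by have /(congr1 (@^~ (partprod (T := T) r x))) /= -> := tA.2 i.
Qed.

Lemma toeplitz_iter k x : iter k C (A (iter k P x)) = A x.
Proof.
have CAP z : C (A (P z)) = A z by exact: toeplitz_partprod.
by elim: k x => [//|k IH] x; rewrite iterSr [iter k.+1 P x]iterS CAP IH.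
Qed.

(** If [A] is the compression of [Y], then [iter m C (A (y (m + n)))] is close to
    the entry at [n] of [Y y] for large [m]. The limit defines [Y]. *)
Definition toeplitz_lift_seq (y : K) n m := iter m C (A (y (m + n)%N)).

Definition toeplitz_lift_entry (y : K) n : H :=
  lim (toeplitz_lift_seq y n m @[m --> \oo]).

Lemma toeplitz_lift_seq_le y n m :
  rnorm (toeplitz_lift_seq y n m) <= opnorm A * rnorm y.
Proof.
rewrite (le_trans (iter_le _ _ _))//; first exact: cfun_le.
by rewrite (le_trans (opnorm_ub bA _))// ler_wpM2l ?opnorm_ge0// ev_le.
Qed.

(** Write [A] as [C^k A P^k] in the term of index [m]: consecutive terms differ
    by the image of [y (m + n + k) - P^k (y (m + n))], which [gap_orbit] bounds. *)
Lemma cvg_toeplitz_lift y n :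
  toeplitz_lift_seq y n m @[m --> \oo] --> toeplitz_lift_entry y n.
Proof.
apply: (@cauchy_modulus _ _ _ (fun m =>
    opnorm A ^+ 2 * (rnorm y ^+ 2 - rnorm (y (m + n)%N) ^+ 2))).
  move=> m k; rewrite /toeplitz_lift_seq -[A (y (m + n)%N)](toeplitz_iter k).
  rewrite -iterD -(linB (iter_lin _ (cfun_lin C))) -(linB (bounded_lin bA)).
  rewrite -addnA [(k + n)%N]addnC addnA.
  set v := _ - _.
  apply: (@le_trans _ _ ((opnorm A * rnorm v) ^+ 2)).
    rewrite ler_pXn2r// ?nnegrE ?mulr_ge0 ?rnorm_ge0 ?opnorm_ge0//.
    rewrite (le_trans (iter_le _ _ _))//; first exact: cfun_le.
    exact: opnorm_ub.
  rewrite exprMn ler_wpM2l ?sqr_ge0// (le_trans (gap_orbit hP PC _ _ _))//.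
  by rewrite lerD2r ler_pXn2r// ?nnegrE ?rnorm_ge0// ev_le.
rewrite -[X in _ --> X](mulr0 (opnorm A ^+ 2)).
by apply: cvgM; [exact: cvg_cst|exact: cvg_ev_gap].
Qed.

Lemma toeplitz_lift_backward y : toeplitz_lift_entry y \in backward C.
Proof.
apply/asboolP; split=> [n|].
  apply: (@limH_unique _ _ _ \oo _ (fun m => toeplitz_lift_seq y n m.+1)).
    rewrite (_ : (fun m => _) = fun m => C (toeplitz_lift_seq y n.+1 m)).
      by apply: bounded_cvg; [exact: cfun_bounded|exact: cvg_toeplitz_lift].
    by apply/funext => m; rewrite /toeplitz_lift_seq /= addSnnS.
  by have := @cvg_toeplitz_lift y n; rewrite -cvg_shiftS.
exists (opnorm A * rnorm y) => n.
apply: (cvgr_to_le (cvg_rnorm (@cvg_toeplitz_lift y n))); apply: nearW => m.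
exact: toeplitz_lift_seq_le.
Qed.

Definition toeplitz_lift y : K := Orbit (toeplitz_lift_backward y).

Lemma toeplitz_lift_bounded : bounded_operator toeplitz_lift.
Proof.
split=> [a y z|].
  apply: orbitP => n; apply: (limH_unique (@cvg_toeplitz_lift _ _)).
  rewrite (_ : (fun m => _) =
      fun m => a *: toeplitz_lift_seq y n m + toeplitz_lift_seq z n m).
    by apply: cvgD; [apply: cvgZl_tmp|]; exact: cvg_toeplitz_lift.
  apply/funext => m; rewrite /toeplitz_lift_seq evD evZ (bounded_lin bA).
  by rewrite (iter_lin m (cfun_lin C)).
exists (opnorm A) => y; apply: (asymptotic_le (asymptotic_ev _)) => n.
apply: (cvgr_to_le (cvg_rnorm (@cvg_toeplitz_lift y n))); apply: nearW => m.
exact: toeplitz_lift_seq_le.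
Qed.

(** Up to null sequences [ext i] acts as [T i] on the entries, and the adjoint of
    [T i] on the other side cancels it because [A] is Toeplitz. *)
Lemma toeplitz_lift_commutant : commutant (range U) toeplitz_lift.
Proof.
apply: commutantP => [|i y]; first exact: toeplitz_lift_bounded.
apply: orbitP => n; have bTi' := adj_bounded (hT i).1.
have Vl : adj (T i) (toeplitz_lift_seq (U i y) n m) @[m --> \oo] -->
    V i (toeplitz_lift (U i y)) n.
  exact: bounded_cvg bTi' (@cvg_toeplitz_lift _ _).
apply: (limH_unique Vl).
have cTC m x : adj (T i) (iter m C x) = iter m C (adj (T i) x).
  elim: m => [//|m IH] /=; rewrite -IH.
  apply: adj_comm; [exact: (hT i).1|exact: hP.1|].
  by move=> z; rewrite (opprod_comm comT).
rewrite (_ : (fun m => _) = fun m => toeplitz_lift_seq y n m +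
    iter m C (adj (T i) (A (U i y (m + n)%N - T i (y (m + n)%N))))).
  rewrite -[X in _ --> X]addr0; apply: cvgD; first exact: cvg_toeplitz_lift.
  apply/cvg_rnormBP; apply: (@squeeze0 _ _ _ _ _ (fun m =>
      opnorm A * rnorm (T i (y (m + n)%N) - U i y (m + n)%N))) => [m|].
    rewrite rnorm_ge0 subr0 (le_trans (iter_le _ _ _))//; first exact: cfun_le.
    have /contractiveP[_ T1] := adj_contractive (hT i).
    by rewrite (le_trans (T1 _))// rnormBC; exact: opnorm_ub.
  rewrite -(mulr0 (opnorm A)); apply: cvgM; first exact: cvg_cst.
  by have := asymptotic_ext comT i y; rewrite /asymptotic -(cvg_shiftn n).
apply/funext => m; rewrite cTC /toeplitz_lift_seq.
rewrite -[A (y (m + n)%N)](congr1 (@^~ _) (tA.2 i)) /=.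
rewrite -(linD (iter_lin m (cfun_lin C))) -(linD (adj_lin (hT i).1)).
by rewrite -(linD (bounded_lin bA)) addrC subrK.
Qed.

(** [J x] is asymptotic to [P^n x], on which the defining sequence is constant. *)
Lemma compression_toeplitz_lift : pseudo_compression J toeplitz_lift = A.
Proof.
apply/funext => x; rewrite compressionE.
apply: (limH_unique (@cvg_toeplitz_lift _ _)); apply/cvg_rnormBP.
apply: (@squeeze0 _ _ _ _ _ (fun m =>
    opnorm A * rnorm (iter m P x - J x m))) => [m|].
  rewrite rnorm_ge0 /toeplitz_lift_seq addn0 -[in A x](toeplitz_iter m).
  rewrite -(linB (iter_lin m (cfun_lin C))) -(linB (bounded_lin bA)).
  rewrite (le_trans (iter_le _ _ _))//; first exact: cfun_le.
  by rewrite [X in _ <= _ * X]rnormBC; exact: opnorm_ub.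
rewrite -(mulr0 (opnorm A)); apply: cvgM; first exact: cvg_cst.
exact: asymptotic_canonicalMap.
Qed.

End Lift.

End Compression.

(** * Operator matrices *)

Section OperatorMatrices.
Context {R : realType}.
Implicit Types H K : hilbertType R.

Lemma ler_rnorm_sum H (I : Type) (r : seq I) (F : I -> H) :
  rnorm (\sum_(i <- r) F i) <= \sum_(i <- r) rnorm (F i).
Proof.
elim: r => [|i r IH]; first by rewrite !big_nil rnorm0.
by rewrite !big_cons (le_trans (ler_rnormD _ _))// lerD2l.
Qed.

Lemma cvg_sum_ord n (f : 'I_n -> nat -> R) (l : 'I_n -> R) :
  (forall i, f i m @[m --> \oo] --> l i) ->
  \sum_(i < n) f i m @[m --> \oo] --> \sum_(i < n) l i.
Proof.
elim: n f l => [|n IH] f l fl.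
  by under eq_fun do rewrite big_ord0; rewrite big_ord0; exact: cvg_cst.
under eq_fun do rewrite big_ord_recl; rewrite big_ord_recl.
by apply: cvgD => //; exact: IH.
Qed.

Lemma l2norm_le H K n (x : 'I_n -> H) (y : 'I_n -> K) :
  (forall i, rnorm (x i) <= rnorm (y i)) -> l2norm x <= l2norm y.
Proof.
move=> xy; apply: ler_wsqrtr; apply: ler_sum => i _.
by rewrite ler_pXn2r// nnegrE rnorm_ge0.
Qed.

Lemma rnorm_le_l2norm H n (x : 'I_n -> H) i : rnorm (x i) <= l2norm x.
Proof.
rewrite -[rnorm (x i)]ger0_norm ?rnorm_ge0// -sqrtr_sqr; apply: ler_wsqrtr.
rewrite (bigD1 i)//= lerDl sumr_ge0// => j _; exact: sqr_ge0.
Qed.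

Lemma l2norm0 H n : l2norm (fun _ : 'I_n => (0 : H)) = 0.
Proof.
by rewrite /l2norm big1 ?sqrtr0// => i _; rewrite rnorm0 expr0n.
Qed.

Definition mxapply H n (A : 'M[H -> H]_n) (x : 'I_n -> H) : 'I_n -> H :=
  fun i => \sum_(j < n) A i j (x j).

Lemma mxopnorm_le H n (A : 'M[H -> H]_n) (M : R) :
  (forall x, l2norm x <= 1 -> l2norm (mxapply A x) <= M) -> mxopnorm A <= M.
Proof.
move=> AM; apply: ge_sup; last by move=> _ [x x1 <-]; exact: AM.
by exists (l2norm (mxapply A (fun=> 0))), (fun=> 0) => //=; rewrite l2norm0.
Qed.

(** Boundedness of the entries makes the supremum defining [mxopnorm] finite. *)
Lemma mxopnorm_ub H n (A : 'M[H -> H]_n) :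
  (forall i j, bounded_operator (A i j)) ->
  forall x, l2norm x <= 1 -> l2norm (mxapply A x) <= mxopnorm A.
Proof.
move=> bA x x1; apply: ub_le_sup; last by exists x.
exists (Num.sqrt (\sum_i (\sum_j opnorm (A i j)) ^+ 2)) => _ [z z1 <-].
apply: ler_wsqrtr; apply: ler_sum => i _.
have A0 : 0 <= \sum_j opnorm (A i j) by apply: sumr_ge0 => j _; exact: opnorm_ge0.
rewrite ler_pXn2r// ?nnegrE ?rnorm_ge0// (le_trans (ler_rnorm_sum _ _))//.
apply: ler_sum => j _; rewrite (le_trans (opnorm_ub (bA i j) _))//.
rewrite ler_piMr ?opnorm_ge0//; exact: le_trans (rnorm_le_l2norm z j) z1.
Qed.

End OperatorMatrices.

(** * Asymptotic intertwining and the symbol *)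

Section Symbol.
Context {R : realType} {H : hilbertType R} {C : contrOperator H}.
Local Notation K := (orbitSpace C).
Implicit Types (A B : H -> H) (Y Z : K -> K).

Definition intertwined A Y :=
  forall y : K, asymptotic (fun n => A (y n)) (Y y).

Lemma intertwined_unique A Y Z : intertwined A Y -> intertwined A Z -> Y = Z.
Proof. by move=> AY AZ; apply/funext => y; exact: asymptotic_unique (AY y) (AZ y). Qed.

Lemma intertwined_id : intertwined idfun idfun.
Proof. by move=> y; exact: asymptotic_ev. Qed.

Lemma intertwined_lincomb (a : R[i]) A B Y Z :
  intertwined A Y -> intertwined B Z -> intertwined (a *: A + B) (a *: Y + Z).
Proof. by move=> AY BZ y; exact: asymptotic_lincomb (AY y) (BZ y). Qed.

(** Apply the relation of [A] and [Y] to the backward orbit [Z y]. *)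
Lemma intertwined_comp A B Y Z : bounded_operator A ->
  intertwined A Y -> intertwined B Z -> intertwined (A \o B) (Y \o Z).
Proof.
move=> bA AY BZ y; apply: asymptotic_trans (AY (Z y)) => /=.
apply: (@squeeze0 _ _ _ _ _
    (fun n => opnorm A * rnorm (B (y n) - Z y n))) => [n|].
  by rewrite rnorm_ge0 -(linB (bounded_lin bA)) opnorm_ub.
by rewrite -(mulr0 (opnorm A)); apply: cvgM; [exact: cvg_cst|exact: BZ].
Qed.

Lemma intertwined_le A Y (c : R) : 0 <= c ->
  (forall x, rnorm (A x) <= c * rnorm x) -> intertwined A Y ->
  forall y, rnorm (Y y) <= c * rnorm y.
Proof.
move=> c0 Ac AY y; apply: (asymptotic_le (AY y)) => n.
by rewrite (le_trans (Ac _))// ler_wpM2l// ev_le.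
Qed.

Lemma intertwined_bounded A Y :
  bounded_operator A -> intertwined A Y -> bounded_operator Y.
Proof.
move=> bA AY; split=> [a y z|]; last first.
  exists (opnorm A); apply: (intertwined_le _ _ AY); first exact: opnorm_ge0.
  exact: opnorm_ub.
apply: asymptotic_unique (AY _) _.
rewrite /asymptotic.
have := asymptotic_lincomb a (AY y) (AY z); rewrite /asymptotic.
by under [X in _ -> X @ _ --> _]eq_fun do rewrite evD evZ (bounded_lin bA).
Qed.

(** The vectors [Y m y] form a Cauchy sequence because [Y m] depends
    contractively on [B m]; the limit is intertwined by a uniform approximation
    argument. *)
Lemma intertwined_lim A (B : nat -> H -> H) (Y : nat -> K -> K) :
  (forall m x, rnorm (A x - B m x) <= m.+1%:R^-1 * rnorm x) ->
  (forall m, intertwined (B m) (Y m)) ->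
  exists Z, intertwined A Z /\ forall y, Y m y @[m --> \oo] --> Z y.
Proof.
move=> AB BY; have e0 m : 0 <= m.+1%:R^-1 :> R by rewrite invr_ge0.
have Ycvg y : cvgn (Y^~ y).
  apply: (@cauchy_modulus _ _ _ (fun m => (2 * rnorm y) ^+ 2 * (m.+1%:R^-1) ^+ 2)).
    move=> m k; rewrite -exprMn ler_pXn2r// ?nnegrE ?mulr_ge0 ?rnorm_ge0//.
    have BB : asymptotic (fun n => (-1) *: B m (y n) + B (m + k)%N (y n))
        ((-1) *: Y m y + Y (m + k)%N y).
      exact: asymptotic_lincomb (BY _ _) (BY _ _).
    rewrite addrC -scaleN1r; apply: (asymptotic_le BB) => n.
    rewrite scaleN1r addrC (le_trans (ler_rnormB _ (A (y n)) _))//.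
    rewrite [X in X + _]rnormBC (le_trans (lerD (AB _ _) (AB _ _)))//.
    rewrite -mulrDl mulrAC ler_pM ?addr_ge0 ?rnorm_ge0 ?ev_le//.
    rewrite mulr_natl mulr2n lerD2r lef_pV2 ?posrE ?ltr0n// ler_nat ltnS.
    exact: leq_addr.
  rewrite -(mulr0 ((2 * rnorm y) ^+ 2)); apply: cvgM; first exact: cvg_cst.
  by have := cvg_sqr (@cvg_harmonic R); rewrite expr0n; apply.
exists (fun y => lim (Y m y @[m --> \oo])); split=> // y.
set Zy := lim _; have YZ : Y m y @[m --> \oo] --> Zy by exact: Ycvg.
apply/cvgr0Pnorm_lt => e e_gt0.
have bnd : m.+1%:R^-1 * rnorm y + rnorm (Y m y - Zy) @[m --> \oo] --> (0 : R).
  rewrite -(addr0 0); apply: cvgD; last by apply/cvg_rnormBP.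
  by rewrite -(mul0r (rnorm y)); apply: cvgM; [exact: cvg_harmonic|exact: cvg_cst].
have e2 : 0 < e / 2 by rewrite divr_gt0.
have [m _ /(_ m (leqnn m)) me] := (cvgr0Pnorm_lt _).1 bnd _ e2.
have [p _ pe] := (cvgr0Pnorm_lt _).1 (BY m y) _ e2.
exists p => // n /= /pe; rewrite /= !ger0_norm ?rnorm_ge0// => ne.
rewrite (le_lt_trans (ler_rnormB _ (B m (y n)) _))//.
have h1 := ler_rnormB (B m (y n)) (Y m y n) (Zy n).
have h2 := ev_le (Y m y - Zy) n; rewrite evB in h2.
have h3 : rnorm (A (y n) - B m (y n)) <= m.+1%:R^-1 * rnorm y.
  by rewrite (le_trans (AB _ _))// ler_wpM2l// ev_le.
have h4 := le_lt_trans (ler_norm _) me.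
move: ne h1 h2 h3 h4; move: (_ * rnorm y) => ?; lra.
Qed.

(** A vector of backward orbits is approximated, with its norm, by the vectors of
    entries at [m], to which the matrix [A] applies. *)
Lemma intertwined_mx n (A : 'M[H -> H]_n) (Y : 'M[K -> K]_n) :
  (forall i j, bounded_operator (A i j)) ->
  (forall i j, intertwined (A i j) (Y i j)) -> mxopnorm Y <= mxopnorm A.
Proof.
move=> bA AY; apply: mxopnorm_le => y y1.
pose u i m := \sum_(j < n) A i j (y j m).
have uY i : asymptotic (u i) (mxapply Y y i).
  by apply: asymptotic_sum => j; exact: AY.
have /(continuous_cvg _ (@sqrt_continuous R _)) ucvg :
    \sum_(i < n) rnorm (u i m) ^+ 2 @[m --> \oo] -->
    \sum_(i < n) rnorm (mxapply Y y i) ^+ 2.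
  apply: cvg_sum_ord => i; apply: cvg_sqr.
  exact: cvg_rnorm_asymptotic (uY i).
apply: (cvgr_to_le ucvg); apply: nearW => m.
apply: (mxopnorm_ub bA (x := fun j => y j m)).
by apply: le_trans y1; apply: l2norm_le => j; exact: ev_le.
Qed.

(** Total by choice; meaningful for operators that are intertwined with some
    operator of the orbit space. *)
Definition symbol A : K -> K := xget (fun=> 0) [set Y | intertwined A Y].

Lemma symbolE A Y : intertwined A Y -> symbol A = Y.
Proof.
move=> AY; apply: xget_unique => [|Z AZ]; first exact: AY.
exact: intertwined_unique AZ AY.
Qed.

End Symbol.

(** * The algebra of operators with a symbol *)

Section SymbolAlgebra.
Context {R : realType} {H : hilbertType R} {d : nat} {T : 'I_d -> H -> H}.
Hypotheses (hT : forall i, contractive (T i)) (comT : commuting T).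

Local Notation P := (opprod T).
Local Notation C := (adjoint_product hT).
Local Notation K := (orbitSpace C).
Local Notation J := (@cano R H d T hT).
Local Notation U := (@ext R H d T hT comT).
Implicit Types (A B : H -> H) (Y Z : K -> K).

(** The adjoints have to be included: the adjoint of an intertwined pair need not
    be intertwined. *)
Definition symbol_of A Y :=
  [/\ commutant (range U) Y, intertwined A Y & intertwined (adj A) (adj Y)].

Definition symbol_algebra : set (H -> H) :=
  [set A | bounded_operator A /\ exists Y, symbol_of A Y].

Lemma commutant_id : commutant (range U) idfun.
Proof. by split; [exact: bounded_id|]. Qed.

Lemma commutant_lincomb (a : R[i]) Y Z :
  commutant (range U) Y -> commutant (range U) Z ->
  commutant (range U) (a *: Y + Z).
Proof.
move=> cY cZ; split; first by apply: bounded_lincomb; [exact: cY.1|exact: cZ.1].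
move=> _ [i _ <-]; apply/funext => y /=; rewrite !lincombE.
rewrite (commutant_ext _ _ cY) (commutant_ext _ _ cZ).
by rewrite (bounded_lin (ext_bounded hT comT i)).
Qed.

Lemma commutant_comp Y Z :
  commutant (range U) Y -> commutant (range U) Z -> commutant (range U) (Y \o Z).
Proof.
move=> cY cZ; split; first by apply: bounded_comp; [exact: cY.1|exact: cZ.1].
move=> _ [i _ <-]; apply/funext => y /=.
by rewrite (commutant_ext _ _ cZ) (commutant_ext _ _ cY).
Qed.

Lemma symbol_of_id : symbol_of idfun idfun.
Proof.
split; [exact: commutant_id|exact: intertwined_id|].
by rewrite !adj_id; exact: intertwined_id.
Qed.

Lemma symbol_of_lincomb (a : R[i]) A B Y Z :
  bounded_operator A -> bounded_operator B ->
  symbol_of A Y -> symbol_of B Z -> symbol_of (a *: A + B) (a *: Y + Z).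
Proof.
move=> bA bB [cY AY AY'] [cZ BZ BZ']; split.
- exact: commutant_lincomb.
- exact: intertwined_lincomb.
- rewrite (adj_lincomb a bA bB) (adj_lincomb a cY.1 cZ.1).
  exact: intertwined_lincomb.
Qed.

Lemma symbol_of_comp A B Y Z : bounded_operator A -> bounded_operator B ->
  symbol_of A Y -> symbol_of B Z -> symbol_of (A \o B) (Y \o Z).
Proof.
move=> bA bB [cY AY AY'] [cZ BZ BZ']; split.
- exact: commutant_comp.
- exact: intertwined_comp.
- rewrite (adj_comp bA bB) (adj_comp cY.1 cZ.1).
  by apply: intertwined_comp => //; exact: adj_bounded.
Qed.

Lemma symbol_of_adj A Y : bounded_operator A ->
  symbol_of A Y -> symbol_of (adj A) (adj Y).
Proof.
move=> bA [cY AY AY']; split; [exact: commutant_adj|exact: AY'|].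
by rewrite (adjK bA) (adjK cY.1); exact: AY.
Qed.

Lemma symbol_of_compression Y : commutant (range U) Y ->
  symbol_of (pseudo_compression J Y) Y.
Proof.
move=> cY; split=> //; first by move=> y; exact: asymptotic_compression.
rewrite (adj_compression cY.1) => y; apply: asymptotic_compression.
exact: commutant_adj.
Qed.

Lemma adjB A B : bounded_operator A -> bounded_operator B ->
  adj (A - B) = adj A - adj B.
Proof.
move=> bA bB; apply: adjP => [a x y|x y].
  rewrite -![(A - B) _]/(A _ - B _) (bounded_lin bA) (bounded_lin bB).
  by rewrite scalerBr addrACA opprD.
rewrite -[(A - B) x]/(A x - B x) -[(adj A - adj B) y]/(adj A y - adj B y).
by rewrite rinBl rinBr (rin_adj bA) (rin_adj bB).
Qed.

Lemma boundedB A B : bounded_operator A -> bounded_operator B ->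
  bounded_operator (A - B).
Proof.
move=> bA bB; have := bounded_lincomb (-1) bB bA.
by rewrite scaleN1r addrC.
Qed.

(** The approximating operators and their adjoints converge in norm, so both
    families of symbols converge pointwise; the two limits are adjoint to each
    other by continuity of the inner product. *)
Lemma symbol_of_lim A : bounded_operator A ->
  (forall e : R, 0 < e -> exists2 B, symbol_algebra B & opnorm (A - B) < e) ->
  exists Y, symbol_of A Y.
Proof.
move=> bA Alim.
have /choice[BY BYP] m : exists BY : (H -> H) * (K -> K),
    [/\ bounded_operator BY.1, symbol_of BY.1 BY.2 &
        opnorm (A - BY.1) <= m.+1%:R^-1].
  have [|B [bB [Y BY]] /ltW AB] := Alim m.+1%:R^-1; first by rewrite invr_gt0.
  by exists (B, Y).
have AB m x : rnorm (A x - (BY m).1 x) <= m.+1%:R^-1 * rnorm x.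
  have [bB _ h] := BYP m.
  rewrite (le_trans (opnorm_ub (boundedB bA bB) x))//.
  by rewrite ler_wpM2r ?rnorm_ge0.
have AB' m x : rnorm (adj A x - adj (BY m).1 x) <= m.+1%:R^-1 * rnorm x.
  have [bB _ _] := BYP m.
  rewrite -[_ - _]/((adj A - adj (BY m).1) x) -(adjB bA bB).
  apply: (adj_ub (boundedB bA bB)); first by rewrite invr_ge0.
  exact: AB.
have [|Y [AY Ylim]] := intertwined_lim AB (Y := fun m => (BY m).2).
  by move=> m; have [_ []] := BYP m.
have [|Y' [AY' Y'lim]] := intertwined_lim AB' (Y := fun m => adj (BY m).2).
  by move=> m; have [_ []] := BYP m.
have bY : bounded_operator Y by exact: intertwined_bounded AY.
have YY' : adj Y = Y'.
  apply: adjP => [|x y]; first exact: bounded_lin bY.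
  apply: (limR_unique (cvg_rin (Ylim x) (cvg_cst y))).
  rewrite (_ : (fun m => _) = fun m => rin x (adj (BY m).2 y)).
    by apply: cvg_rin; [exact: cvg_cst|exact: Y'lim].
  apply/funext => m; have [_ [[bBY _] _ _] _] := BYP m.
  by rewrite (rin_adj bBY).
exists Y; split=> //; last by rewrite YY'.
split=> // _ [i _ <-]; apply/funext => y /=.
apply: (limH_unique (Ylim _)).
rewrite (_ : (fun m => _) = fun m => U i ((BY m).2 y)).
  by apply: bounded_cvg (Ylim y); exact: ext_bounded.
by apply/funext => m; have [_ [cY _ _] _] := BYP m; rewrite (commutant_ext _ _ cY).
Qed.

Lemma symbol_algebra_cstar : cstar_subalgebra symbol_algebra.
Proof.
have alg_id : symbol_algebra idfun.
  by split; [exact: bounded_id|exists idfun; exact: symbol_of_id].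
have alg_lin (a : R[i]) A B :
    symbol_algebra A -> symbol_algebra B -> symbol_algebra (a *: A + B).
  move=> [bA [Y AY]] [bB [Z BZ]]; split; first exact: bounded_lincomb.
  by exists (a *: Y + Z); exact: symbol_of_lincomb.
split.
- by move=> A [].
- split=> //; have := alg_lin (-1) _ _ alg_id alg_id.
  by rewrite scaleN1r addNr.
- move=> A B [bA [Y AY]] [bB [Z BZ]]; split; first exact: bounded_comp.
  by exists (Y \o Z); exact: symbol_of_comp.
- move=> A [bA [Y AY]]; split; first exact: adj_bounded.
  by exists (adj Y); exact: symbol_of_adj.
- by move=> A bA Alim; split=> //; exact: symbol_of_lim.
Qed.

Local Notation Calg := (cstar_generated ([set idfun] `|` toeplitz T)).

Lemma Calg_sub : Calg `<=` symbol_algebra.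
Proof.
apply: smallest_sub; first exact: symbol_algebra_cstar.
move=> A [->|tA].
  by split; [exact: bounded_id|exists idfun; exact: symbol_of_id].
split; first by case: tA.
exists (toeplitz_lift (hT := hT) tA).
rewrite -{1}(compression_toeplitz_lift hT tA).
apply: symbol_of_compression; exact: toeplitz_lift_commutant.
Qed.

Lemma toeplitz_Calg : toeplitz T `<=` Calg.
Proof. by move=> A tA B [_]; apply; right. Qed.

Lemma Calg_symbol A : Calg A -> symbol_of A (symbol (C := C) A).
Proof.
by move=> /Calg_sub[_ [Y AY]]; have [_ AY1 _] := AY; rewrite (symbolE AY1).
Qed.

Lemma symbol_compression Y : commutant (range U) Y ->
  symbol (pseudo_compression J Y) = Y.
Proof. by move=> /symbol_of_compression[_ /symbolE]. Qed.

Lemma l2norm_contraction (H1 H2 : hilbertType R) (Q : H1 -> H2) n (x : 'I_n -> H1) :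
  contractive Q -> l2norm (fun i => Q (x i)) <= l2norm x.
Proof. by move=> /contractiveP[_ Q1]; exact: l2norm_le. Qed.

(** Compressing by the contraction [J] decreases matrix norms, and so does
    passing to the symbol, which undoes the compression. *)
Lemma compression_mx n (Y : 'M[K -> K]_n) :
  (forall i j, commutant (range U) (Y i j)) ->
  mxopnorm (map_mx (pseudo_compression J) Y) = mxopnorm Y.
Proof.
move=> cY; apply/le_anti/andP; split.
  apply: mxopnorm_le => x x1.
  have J1 : l2norm (fun j => J (x j)) <= 1.
    by apply: le_trans x1; apply: l2norm_contraction; exact: canonicalMap_contractive.
  apply: le_trans (mxopnorm_ub (fun i j => (cY i j).1) J1).
  apply: l2norm_le => i; rewrite /mxapply.
  rewrite (_ : \sum_j _ = (\sum_j Y i j (J (x j)) : K) 0%N); first exact: ev_le.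
  by rewrite ev_sum; apply: eq_bigr => j _; rewrite mxE compressionE.
apply: intertwined_mx => i j; rewrite mxE.
  exact: compression_bounded (cY i j).1.
by have [] := symbol_of_compression (cY i j).
Qed.

(** * Lifting the commutant of the tuple *)

Definition commutant_lift (X : H -> H) : K -> K := symbol (adj J \o J \o X).

Lemma commutant_tuple X i x : commutant (range T) X -> X (T i x) = T i (X x).
Proof.
by move=> [_ /(_ (T i) (ex_intro2 _ _ i I erefl))/(congr1 (@^~ x))].
Qed.

Lemma canoK_toeplitz X : commutant (range T) X -> toeplitz T (adj J \o J \o X).
Proof.
move=> cX; have bJ := cano_bounded hT; split.
  by apply: bounded_comp cX.1; exact: bounded_comp (adj_bounded bJ) bJ.
move=> i; apply/funext => x; rewrite adj_cano.
change (adj (T i) (J (X (T i x)) 0%N) = J (X x) 0%N).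
rewrite (commutant_tuple _ _ cX) (cano_ext hT comT).
rewrite -[LHS]/(@coext R H d T hT comT i _ 0%N).
by rewrite extK.
Qed.

Lemma commutant_liftP X : commutant (range T) X ->
  symbol_of (adj J \o J \o X) (commutant_lift X).
Proof. move=> cX; apply: Calg_symbol; apply: toeplitz_Calg; exact: canoK_toeplitz. Qed.

Lemma compression_commutant_lift X : commutant (range T) X ->
  pseudo_compression J (commutant_lift X) = adj J \o J \o X.
Proof.
move=> cX; have tX := canoK_toeplitz cX.
have := symbol_compression (toeplitz_lift_commutant hT comT tX).
rewrite (compression_toeplitz_lift hT tX) => E.
by rewrite /commutant_lift E (compression_toeplitz_lift hT tX).
Qed.

(** The entry at [n] of [commutant_lift X (J x)] is the value at [iter n P x] of
    its compression [J^* J X], and [X] commutes with [P]. *)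
Lemma commutant_lift_cano X x : commutant (range T) X ->
  commutant_lift X (J x) = J (X x).
Proof.
move=> cX; have [cY _ _] := commutant_liftP cX; set Y := commutant_lift X.
have JP n z : iter n oshift (J z) = J (iter n P z).
  by apply: orbitP => k; rewrite iter_oshiftE !canonicalMapE iterD.
have XP n z : X (iter n P z) = iter n P (X z).
  elim: n => [//|n IH] /=; rewrite -IH /opprod; move: (iter n P z) => w.
  rewrite -/(partprod (T := T) (index_enum 'I_d)).
  elim: (index_enum _) => [|i r IHr]; first by rewrite partprod_nil.
  by rewrite partprod_cons /= -IHr (commutant_tuple _ _ cX).
apply: orbitP => n; rewrite -[LHS](iter_oshiftE n _ 0).
rewrite -(commutant_oshift _ _ cY) JP -compressionE.
by rewrite (compression_commutant_lift cX) /= adj_cano XP.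
Qed.

Lemma commutant_lift_comp X X' :
  commutant (range T) X -> commutant (range T) X' ->
  commutant_lift (X \o X') = commutant_lift X \o commutant_lift X'.
Proof.
move=> cX cX'; have [cY _ _] := commutant_liftP cX.
have [cY' _ _] := commutant_liftP cX'.
rewrite -[RHS](symbol_compression (commutant_comp cY cY')); congr symbol.
apply/funext => x; rewrite compressionE /= !commutant_lift_cano//.
by rewrite adj_cano.
Qed.

Lemma symbol_star_representation :
  unital_star_representation Calg (symbol (C := C)).
Proof.
split.
- by move=> A /Calg_symbol[[]].
- move=> a A B cA cB.
  have [bA _] := Calg_sub cA; have [bB _] := Calg_sub cB.
  by have [_ /symbolE] :=
    symbol_of_lincomb a bA bB (Calg_symbol cA) (Calg_symbol cB).
- move=> A B cA cB.
  have [bA _] := Calg_sub cA; have [bB _] := Calg_sub cB.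
  by have [_ /symbolE] := symbol_of_comp bA bB (Calg_symbol cA) (Calg_symbol cB).
- move=> A cA; have [bA _] := Calg_sub cA.
  by have [_ /symbolE] := symbol_of_adj bA (Calg_symbol cA).
- exact/symbolE/intertwined_id.
Qed.

Lemma canoK_lincomb (a : R[i]) (X X' : H -> H) :
  adj J \o J \o (a *: X + X') = a *: (adj J \o J \o X) + (adj J \o J \o X').
Proof.
apply/funext => x; rewrite lincombE /= lincombE.
by rewrite (bounded_lin (cano_bounded hT)) (adj_lin (cano_bounded hT)).
Qed.

(** The lifting of [X] is the symbol of [J^* J X], and both taking symbols and
    multiplying by the contraction [J^* J] decrease matrix norms. *)
Lemma commutant_lift_completely_contractive :
  completely_contractive (commutant (range T)) commutant_lift.
Proof.
split.
- by move=> X /commutant_liftP[[]].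
- move=> a X X' cX cX'; rewrite /commutant_lift canoK_lincomb.
  have [bX _] := canoK_toeplitz cX; have [bX' _] := canoK_toeplitz cX'.
  by have [_ /symbolE] :=
    symbol_of_lincomb a bX bX' (commutant_liftP cX) (commutant_liftP cX').
move=> n X _ cX; have bJ := cano_bounded hT.
pose QX := map_mx (fun X' : H -> H => adj J \o J \o X') X.
have QX_le : mxopnorm (map_mx commutant_lift X) <= mxopnorm QX.
  apply: intertwined_mx => i j; rewrite !mxE.
    by have [] := canoK_toeplitz (cX i j).
  by have [] := commutant_liftP (cX i j).
apply: le_trans QX_le _; apply: mxopnorm_le => x x1.
apply: le_trans (mxopnorm_ub (fun i j => (cX i j).1) x1); apply: l2norm_le => i.
rewrite /mxapply (_ : \sum_j _ = J (\sum_j X i j (x j)) 0%N).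
  rewrite (le_trans (ev_le _ _))//; exact: canonicalMap_le.
rewrite (lin_sum (bounded_lin bJ)) ev_sum; apply: eq_bigr => j _.
by rewrite mxE /= adj_cano.
Qed.

End SymbolAlgebra.

(** * The canonical unitary pseudo-extension *)

Theorem theorem4p3 (R : realType) (H : hilbertType R) (d : nat)
    (T : 'I_d -> H -> H) :
  (0 < d)%N ->
  (forall i, contractive (T i)) ->
  commuting T ->
  ~ sot_cvg (fun n => iter n (opprod T)) (fun=> 0 : H) ->
  exists (K : hilbertType R) (J : H -> K) (U : 'I_d -> K -> K),
    [/\ canonical_pseudo_extension T J U,
        forall j, unitary_operator (U j),
        (complete_isometry (commutant (range U)) (pseudo_compression J) /\
         pseudo_compression J @` commutant (range U) = toeplitz T)
      & exists pi : (H -> H) -> (K -> K),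
          let Calg := cstar_generated ([set idfun] `|` toeplitz T) in
          [/\ unital_star_representation Calg pi,
              pi @` Calg = commutant (range U),
              forall Y, commutant (range U) Y ->
                pi (pseudo_compression J Y) = Y
            & exists Theta : (H -> H) -> (K -> K),
                [/\ forall X, commutant (range T) X ->
                      Calg (adj J \o J \o X) /\
                      Theta X = pi (adj J \o J \o X),
                    forall X, commutant (range T) X ->
                      commutant (range U) (Theta X),
                    completely_contractive (commutant (range T)) Theta,
                    unital Theta /\
                      multiplicative_on (commutant (range T)) Theta
                  & forall X, commutant (range T) X -> Theta X \o J = J \o X]]].
Proof.
move=> d0 hT comT Pn0.
pose J := @cano R H d T hT; pose U := @ext R H d T hT comT.
have bJ : bounded_operator J := cano_bounded hT.
exists (orbitSpace (adjoint_product hT)), J, U; split.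
- split; last first.
    move=> x; rewrite /= adj_cano.
    exact: (@cvg_asymptote _ _ (adjoint_product hT) _ (opprod_contractive hT) erefl x).
  split; last first.
    move=> M lM cM MU MJ; exact: cano_minimal cM MU MJ.
  split.
  + exact: ext_bounded.
  + exact: ext_commuting.
  + exact: canonicalMap_contractive.
  + move=> J0; apply: Pn0 => x; apply/cvg_rnormBP.
    have /cvg_rnorm_asymptotic :
        asymptotic (fun n => iter n (opprod T) x) (J x).
      exact: asymptotic_canonicalMap.
    by rewrite J0 rnorm0; under [X in _ -> X @ _ --> _]eq_fun do rewrite subr0.
  + by move=> j; apply/funext => x; exact: cano_ext.
- exact: ext_unitary.
- split; [split|].
  + by move=> Y [bY _]; exact: compression_bounded.
  + move=> a Y Z [bY _] [bZ _]; apply/funext => x.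
    by rewrite !lincombE !compressionE.
  + by move=> n Y _; exact: compression_mx.
  + apply/seteqP; split=> [_ [Y cY <-]|A tA]; first exact: compression_toeplitz.
    exists (toeplitz_lift (hT := hT) tA); first exact: toeplitz_lift_commutant.
    exact: compression_toeplitz_lift.
exists (@symbol R H (adjoint_product hT)) => /=.
split.
- exact: symbol_star_representation.
- apply/seteqP; split=> [_ [A /(@Calg_symbol _ _ _ _ hT comT)[cY _ _] <-] //|Y cY].
  exists (pseudo_compression J Y); last exact: symbol_compression cY.
  apply: toeplitz_Calg; exact: compression_toeplitz cY.
- by move=> Y cY; exact: symbol_compression cY.
exists (@commutant_lift R H d T hT); split.
- move=> X cX; split=> //; apply: toeplitz_Calg.
  exact: (canoK_toeplitz hT comT cX).
- by move=> X /(commutant_liftP hT comT)[].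
- exact: commutant_lift_completely_contractive.
- split; last by move=> X X' cX cX'; exact: commutant_lift_comp.
  exact: (symbol_compression (commutant_id hT comT)).
- by move=> X cX; apply/funext => x; exact: commutant_lift_cano.
Qed.
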